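(* Let $k$ be a field, $m\ge1$, and let $I\subset k[x_1,\dots,x_m]$ be a homogeneous ideal such that $k[x_1,\dots,x_m]/I$ is Gorenstein of Krull dimension $d\ge1$. Let $\mathrm{vol}'$ be the normalization defined in the context by means of a homomorphism $\varphi:J\to R$. Then $\mathrm{vol}'$ is well-defined up to an element of $k^*=k\setminus\{0\}$, and it coincides with the KM normalization $\mathrm{vol}$ (defined in the context) up to a factor in $k^*$.
   Context: All $x_j$ have degree $1$. Let $\theta_{i,j}$ ($1\le i\le d$, $1\le j\le m$) be new variables, $R_{up}=k[x_1,\dots,x_m,\theta_{i,j}]$ (bigraded by $x$-degree and $\theta$-degree), $f_i=\sum_{j=1}^m\theta_{i,j}x_j$, $I_{up}\subset R_{up}$ the ideal generated by $I\cup\{f_1,\dots,f_d\}$, $N_{up}=I_{up}:(x_1,\dots,x_m)$. Let $E=k(\theta_{i,j})$, $I_{down}$ the ideal of $E[x_1,\dots,x_m]$ generated by $I\cup\{f_1,\dots,f_d\}$, and $\mathcal{A}=E[x_1,\dots,x_m]/I_{down}$ the generic Artinian reduction, with top degree $e$ ($\mathcal{A}_e\ne0$, $\mathcal{A}_s=0$ for $s>e$). KM normalization $\mathrm{vol}$: the $R_{up}$-module $(N_{up}/I_{up})_{(e,-)}=\bigoplus_{c\ge0}(N_{up}/I_{up})_{(e,c)}$ is cyclic; for a generator $u+I_{up}$, $\mathrm{vol}:\mathcal{A}_e\to E$ is the unique $E$-linear map with $\mathrm{vol}(u+I_{down})=1$. The normalization $\mathrm{vol}'$: let $z$ be a new variable,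 $R=k[x_1,\dots,x_m,\theta_{i,j},z]/(I+(f_1,\dots,f_d))$ and $J=(z,x_1,\dots,x_m)\subset R$. There is a homomorphism $\varphi:J\to R$ which together with the inclusion $\iota:J\to R$ generates the $R$-module $\mathrm{Hom}_R(J,R)$, and it can be chosen so that $\varphi(z)$ is the class of some $h\in k[x_1,\dots,x_m,\theta_{i,j}]$. $\mathrm{vol}':\mathcal{A}_e\to E$ is the $E$-linear map determined by $\mathrm{vol}'(h+I_{down})=1$. *)

(* Defs.v *)
From HB Require Import structures.
From mathcomp Require Import all_boot all_order all_algebra.
From mathcomp Require Import generic_quotient ring_quotient fraction.
From mathcomp Require Import boolp.
From mathcomp Require Import mpoly.

Set Implicit Arguments.
Unset Strict Implicit.
Unset Printing Implicit Defensive.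

Import GRing.Theory.
Local Open Scope ring_scope.
Local Open Scope quotient_scope.

Section Ideals.
Variable A : comPzRingType.
Implicit Types (I J G : A -> Prop) (a b : A).

Definition is_ideal I : Prop :=
  [/\ I 0, forall a b, I a -> I b -> I (a + b) & forall a b, I b -> I (a * b)].

Definition gen_ideal G : A -> Prop := fun a =>
  exists n (c g : 'I_n -> A), (forall i, G (g i)) /\ a = \sum_(i < n) c i * g i.

Lemma gen_ideal_is_ideal G : is_ideal (gen_ideal G).
Proof.
split=> [|a b [n [c [g [Gg ->]]]] [n' [c' [g' [Gg' ->]]]]|a b [n [c [g [Gg ->]]]]].
- by exists 0%N, (fun=> 0), (fun=> 0); split=> [[]|] //; rewrite big_ord0.
- exists (n + n')%N, (fun i => match split i with inl j => c j | inr j => c' j end),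
    (fun i => match split i with inl j => g j | inr j => g' j end); split.
    by move=> i; case: (split i).
  rewrite big_split_ord /=; congr (_ + _); apply: eq_bigr => i _.
    by rewrite (unsplitK (inl i)).
  by rewrite (unsplitK (inr i)).
- exists n, (fun i => a * c i), g; split=> //.
  by rewrite big_distrr /=; apply: eq_bigr => i _; rewrite mulrA.
Qed.

Definition colon I J : A -> Prop := fun a => forall b, J b -> I (a * b).

Definition prime_ideal I : Prop :=
  [/\ is_ideal I, ~ I 1 & forall a b, I (a * b) -> I a \/ I b].

Definition prime_chain (n : nat) : Prop :=
  exists P : 'I_n.+1 -> A -> Prop,
    (forall i, prime_ideal (P i)) /\
    (forall i j : 'I_n.+1, (i < j)%N ->
       (forall a, P i a -> P j a) /\ (exists a, P j a /\ ~ P i a)).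

Definition krull_dim (n : nat) : Prop :=
  prime_chain n /\ forall n', (n < n')%N -> ~ prime_chain n'.

Definition regular_sequence (s : seq A) : Prop :=
  (forall (i : nat) a, (i < size s)%N ->
     gen_ideal (fun b => b \in take i s) (s`_i * a) ->
     gen_ideal (fun b => b \in take i s) a) /\
  ~ gen_ideal (fun b => b \in s) 1.

(* A-linear maps from the ideal J to A, given by total functions whose values
   outside J are irrelevant. *)
Definition hom_from_ideal J (phi : A -> A) : Prop :=
  forall a x y, J x -> J y -> phi (a * x + y) = a * phi x + phi y.

End Ideals.

(* The quotient ring A / (G), for an arbitrary subset G of A. The ring of
   ring_quotient only covers proper ideals, so the (possibly zero) ring
   structure is added here on top of the additive quotient. *)
Section Quotient.
Variables (A : comPzRingType) (G : A -> Prop).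

Definition gen_idealb : {pred A} := fun a => `[< gen_ideal G a >].

Lemma gen_idealb_zmod_closed : zmod_closed gen_idealb.
Proof.
have [I0 ID IM] := gen_ideal_is_ideal G.
split=> [|a b]; rewrite !unfold_in; first exact/asboolP.
move=> /asboolP Ia /asboolP Ib; apply/asboolP/ID => //.
by rewrite -mulN1r; exact: IM.
Qed.

HB.instance Definition _ :=
  GRing.isZmodClosed.Build A gen_idealb gen_idealb_zmod_closed.

Definition quo : Type := Quotient.quot gen_idealb.
HB.instance Definition _ := GRing.Zmodule.on quo.

Definition quo_class (a : A) : quo := \pi_(Quotient.quot gen_idealb) a.
Definition quo_one : quo := quo_class 1.
Definition quo_mul (u v : quo) : quo :=
  quo_class (repr (u : Quotient.quot gen_idealb) * repr (v : Quotient.quot gen_idealb)).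

Lemma quo_classP a b : quo_class a = quo_class b <-> gen_ideal G (a - b).
Proof.
rewrite /quo_class; split=> [/eqP|H]; last apply/eqP.
  by rewrite -Quotient.idealrBE => /asboolP.
by rewrite -Quotient.idealrBE; exact/asboolP.
Qed.

Lemma quo_class_surj (u : quo) : exists a, u = quo_class a.
Proof. by exists (repr (u : Quotient.quot gen_idealb)); rewrite /quo_class reprK. Qed.

Lemma quo_class_add a b : quo_class (a + b) = quo_class a + quo_class b.
Proof. exact: (raddfD (\pi_(Quotient.quot gen_idealb))). Qed.

Lemma quo_class_mul a b : quo_class (a * b) = quo_mul (quo_class a) (quo_class b).
Proof.
have [_ ID IM] := gen_ideal_is_ideal G.
rewrite /quo_mul; set a' := repr _; set b' := repr _.
have /quo_classP Ha : quo_class a = quo_class a' by rewrite {2}/quo_class reprK.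
have /quo_classP Hb : quo_class b = quo_class b' by rewrite {2}/quo_class reprK.
apply/quo_classP; have -> : a * b - a' * b' = b * (a - a') + a' * (b - b').
  by rewrite !mulrBr addrA (mulrC b a) (mulrC b a') subrK.
by apply: ID; apply: IM.
Qed.

Lemma quo_mulA : associative quo_mul.
Proof.
move=> u v w; have [a ->] := quo_class_surj u; have [b ->] := quo_class_surj v.
have [c ->] := quo_class_surj w.
by rewrite -!quo_class_mul mulrA.
Qed.

Lemma quo_mulC : commutative quo_mul.
Proof. by move=> u v; rewrite /quo_mul mulrC. Qed.

Lemma quo_mul1 : left_id quo_one quo_mul.
Proof. by move=> u; have [a ->] := quo_class_surj u; rewrite -quo_class_mul mul1r. Qed.

Lemma quo_mulDl : left_distributive quo_mul +%R.
Proof.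
move=> u v w; have [a ->] := quo_class_surj u; have [b ->] := quo_class_surj v.
have [c ->] := quo_class_surj w.
by rewrite -quo_class_add -!quo_class_mul mulrDl quo_class_add.
Qed.

HB.instance Definition _ := GRing.Zmodule_isComPzRing.Build quo
  quo_mulA quo_mulC quo_mul1 quo_mulDl.

Lemma quo_class_is_zmod_morphism : zmod_morphism quo_class.
Proof. exact: (raddfB (\pi_(Quotient.quot gen_idealb))). Qed.

Lemma quo_class_is_monoid_morphism : monoid_morphism quo_class.
Proof. by split=> // a b; exact: quo_class_mul. Qed.

HB.instance Definition _ :=
  GRing.isZmodMorphism.Build A quo quo_class quo_class_is_zmod_morphism.
HB.instance Definition _ :=
  GRing.isMonoidMorphism.Build A quo quo_class quo_class_is_monoid_morphism.

End Quotient.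

Section GradedAlgebras.
Variables (F : fieldType) (m : nat).
Local Notation S := {mpoly F[m]}.
Implicit Types (I G : S -> Prop) (t : seq S).

Definition homogeneous_ideal I : Prop :=
  is_ideal I /\
  forall p, I p -> gen_ideal (fun q => I q /\ exists s, q \is s.-homog) p.

Definition quo_scale G (c : F) (a : quo G) : quo G := quo_class G c%:MP * a.

Definition finite_dim_quo G : Prop :=
  exists n (b : 'I_n -> quo G), forall a, exists c : 'I_n -> F,
    a = \sum_(i < n) quo_scale (c i) (b i).

Definition irrelevant G : quo G -> Prop :=
  gen_ideal (fun a => exists j : 'I_m, a = quo_class G 'X_j).

Definition socle G : quo G -> Prop := colon (fun a => a = 0) (@irrelevant G).

Definition one_dimensional_socle G : Prop :=
  exists s : quo G,
    [/\ socle s, s <> 0 & forall a : quo G, socle a -> exists c, a = quo_scale c s].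

Definition add_gens I t : S -> Prop := fun p => I p \/ p \in t.

(* Homogeneous system of parameters of F[x]/I. *)
Definition hsop I t : Prop :=
  [/\ krull_dim (quo I) (size t),
      forall p, p \in t -> exists s, (0 < s)%N /\ p \is s.-homog
    & finite_dim_quo (add_gens I t)].

(* The graded algebra F[x]/I is Gorenstein: it is Cohen-Macaulay (some
   homogeneous system of parameters is a regular sequence) of type 1 (the
   Artinian reduction by that system has a one-dimensional socle). *)
Definition gorenstein I : Prop :=
  exists t, [/\ hsop I t, regular_sequence [seq quo_class I p | p <- t]
              & one_dimensional_socle (add_gens I t)].

Definition quo_degree G (s : nat) (a : quo G) : Prop :=
  exists p : S, p \is s.-homog /\ a = quo_class G p.

Definition top_degree G (e : nat) : Prop :=
  (exists a : quo G, quo_degree e a /\ a <> 0) /\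
  forall s, (e < s)%N -> forall a : quo G, quo_degree s a -> a = 0.

End GradedAlgebras.

(* k[x, theta] is encoded as k[theta][x], with theta_(i,j) the variable of index
   mxvec_index i j, so that the x-degree is the degree in the outer variables. *)
Section Normalizations.
Variables (k : fieldType) (m d : nat) (I : {mpoly k[m]} -> Prop).

Local Notation kth := {mpoly k[d * m]}.
Local Notation Rup := {mpoly kth[m]}.
Local Notation E := {fraction kth}.

Definition theta (i : 'I_d) (j : 'I_m) : kth := 'X_(mxvec_index i j).

Definition generic_form (i : 'I_d) : Rup := \sum_(j < m) (theta i j)%:MP * 'X_j.

Definition up_gens : Rup -> Prop := fun p =>
  (exists q, I q /\ p = map_mpoly (@mpolyC (d * m) k) q) \/
  (exists i, p = generic_form i).

Definition I_up : Rup -> Prop := gen_ideal up_gens.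

Definition x_ideal : Rup -> Prop := gen_ideal (fun p => exists j : 'I_m, p = 'X_j).

Definition N_up : Rup -> Prop := colon I_up x_ideal.

Definition to_down (p : Rup) : {mpoly E[m]} := map_mpoly (@FracField.tofrac kth) p.

Definition down_gens : {mpoly E[m]} -> Prop := fun p =>
  exists q, up_gens q /\ p = to_down q.

Definition artin_red := quo down_gens.

Definition down_class (p : Rup) : artin_red := quo_class down_gens (to_down p).

Definition linear_on_degree (e : nat) (v : artin_red -> E) : Prop :=
  forall (c : E) (a b : artin_red), quo_degree e a -> quo_degree e b ->
    v (quo_scale c a + b) = c * v a + v b.

(* v restricts to an E-linear map on the degree e part, where it sends the
   class of w (required to lie there) to 1; the values of v outside degree e
   are irrelevant. *)
Definition normalized_by (e : nat) (w : Rup) (v : artin_red -> E) : Prop :=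
  [/\ quo_degree e (down_class w), linear_on_degree e v & v (down_class w) = 1].

(* The part of N_up / I_up of x-degree e (and arbitrary theta-degree). *)
Definition NI_degree (e : nat) (a : quo up_gens) : Prop :=
  exists p, [/\ N_up p, p \is e.-homog & a = quo_class up_gens p].

Definition KM_generator (e : nat) (u : Rup) : Prop :=
  NI_degree e (quo_class up_gens u) /\
  forall a, NI_degree e a -> exists r : Rup, a = quo_class up_gens (r * u).

Definition is_KM_vol (e : nat) (v : artin_red -> E) : Prop :=
  exists u, KM_generator e u /\ normalized_by e u v.

(* k[x, theta, z] is encoded as k[theta][x][z]. *)
Definition z_gens : {poly Rup} -> Prop := fun p => exists q, up_gens q /\ p = q%:P.

Definition Rz := quo z_gens.

Definition z_class : Rz := quo_class z_gens 'X.

Definition J_ideal : Rz -> Prop := gen_ideal (fun a =>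
  a = z_class \/ exists j : 'I_m, a = quo_class z_gens ('X_j)%:P).

Definition generates_hom_with_inclusion (phi : Rz -> Rz) : Prop :=
  hom_from_ideal J_ideal phi /\
  forall psi, hom_from_ideal J_ideal psi ->
    exists a b : Rz, forall x, J_ideal x -> psi x = a * phi x + b * x.

Definition vol'_choice (phi : Rz -> Rz) (h : Rup) : Prop :=
  generates_hom_with_inclusion phi /\ phi z_class = quo_class z_gens h%:P.

Definition is_vol' (e : nat) (v : artin_red -> E) : Prop :=
  exists phi h, vol'_choice phi h /\ normalized_by e h v.

Definition agree_on_degree (e : nat) (v w : artin_red -> E) : Prop :=
  forall a, quo_degree e a -> v a = w a.

Definition agree_up_to_unit (e : nat) (v w : artin_red -> E) : Prop :=
  exists c : k, c != 0 /\
    forall a, quo_degree e a -> w a = FracField.tofrac c%:MP * v a.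

End Normalizations.

Arguments up_gens {k m} d I _.
Arguments down_gens {k m} d I _.
Arguments normalized_by {k m} d I e w v.
Arguments KM_generator {k m} d I e u.
Arguments is_KM_vol {k m} d I e v.
Arguments vol'_choice {k m} d I phi h.
Arguments is_vol' {k m} d I e v.
Arguments agree_on_degree {k m} d I e v w.
Arguments agree_up_to_unit {k m} d I e v w.

(* Main.v *)
(** Write [A = k[x]/I], [m = (x_1, ..., x_m)] and let [t] be a homogeneous system
    of parameters of [A] as provided by the Gorenstein hypothesis.  In [A[theta]]
    every mixed sequence [t_1, ..., t_i, f_1, ..., f_j] with [i + j <= d] is
    regular: a generic linear form is a nonzerodivisor as soon as the ideal [m]
    contains one.  If [b, c] in [m] are both nonzerodivisors modulo [K], then
    [c u = b v] defines an isomorphism between [((K, b) : m) / (K, b)] and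
    [((K, c) : m) / (K, c)].  Exchanging the [t_i] for the [f_j] one at a time, the
    one-dimensional socle of [A/(t)], tensored with [k[theta]], becomes
    [N_up / I_up], which is thus free of rank one over [k[theta]].  Its generator [u]
    is unique up to [k^*]; localizing at [k[theta] - 0], it spans the top degree of
    the generic Artinian reduction.
    A homomorphism [psi : J -> R] satisfies [x_j psi(z) = z psi(x_j)], so the
    constant coefficient in [z] of [psi(z)] lies in [N_up], and [psi] is determined
    modulo the multiples of the inclusion by this coefficient.  Hence the
    admissible [h] are exactly the generators of [N_up / I_up]. *)

Require Import Defs.
From HB Require Import structures.
From mathcomp Require Import all_boot all_order all_algebra.
From mathcomp Require Import generic_quotient fraction mpoly boolp ring.

Set Implicit Arguments.
Unset Strict Implicit.
Unset Printing Implicit Defensive.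

Import GRing.Theory.
Local Open Scope ring_scope.

(** * Ideals and nonzerodivisors modulo an ideal *)

Section IdealFacts.
Variable A : comPzRingType.
Implicit Types (K G : A -> Prop) (a b c p q u v w x y : A).

Lemma is_ideal0 K : is_ideal K -> K 0.
Proof. by case. Qed.

Lemma is_idealD K a b : is_ideal K -> K a -> K b -> K (a + b).
Proof. by case=> _ KD _; apply: KD. Qed.

Lemma is_idealMl K a b : is_ideal K -> K b -> K (a * b).
Proof. by case=> _ _; apply. Qed.

Lemma is_idealMr K a b : is_ideal K -> K a -> K (a * b).
Proof. by rewrite mulrC; apply: is_idealMl. Qed.

Lemma is_idealN K a : is_ideal K -> K a -> K (- a).
Proof. by move=> idK Ka; rewrite -mulN1r; apply: is_idealMl. Qed.

Lemma is_idealB K a b : is_ideal K -> K a -> K b -> K (a - b).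
Proof. by move=> idK Ka Kb; apply: is_idealD => //; apply: is_idealN. Qed.

Lemma is_ideal_sum K (T : Type) (r : seq T) (P : pred T) (F : T -> A) :
  is_ideal K -> (forall i, P i -> K (F i)) -> K (\sum_(i <- r | P i) F i).
Proof.
move=> idK KF; apply: (big_ind K) => //; first exact: is_ideal0.
by move=> a b; apply: is_idealD.
Qed.

Lemma is_ideal_congr K a b : is_ideal K -> K (a - b) -> K b -> K a.
Proof. by move=> idK Kab Kb; rewrite -(subrK b a); apply: is_idealD. Qed.

Lemma gen_ideal_mem G a : G a -> gen_ideal G a.
Proof.
move=> Ga; exists 1%N, (fun=> 1), (fun=> a); split=> //.
by rewrite big_ord1 mul1r.
Qed.

Lemma gen_ideal_sub G K a : is_ideal K -> (forall b, G b -> K b) ->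
  gen_ideal G a -> K a.
Proof.
move=> idK GK [n [c [g [Gg ->]]]]; apply: is_ideal_sum => // i _.
by apply: is_idealMl => //; apply: GK.
Qed.

Lemma gen_ideal_mono G G' a : (forall b, G b -> G' b) ->
  gen_ideal G a -> gen_ideal G' a.
Proof.
move=> GG'; apply: gen_ideal_sub; first exact: gen_ideal_is_ideal.
by move=> b /GG'; apply: gen_ideal_mem.
Qed.

Lemma colon_gen K G a : is_ideal K -> (forall b, G b -> K (a * b)) ->
  colon K (gen_ideal G) a.
Proof.
move=> idK KG b; apply: (gen_ideal_sub (K := fun b => K (a * b))) => //.
split=> [|x y Kx Ky|x y Ky]; first by rewrite mulr0; apply: is_ideal0.
  by rewrite mulrDr; apply: is_idealD.
by rewrite mulrCA; apply: is_idealMl.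
Qed.

Definition ideal_add K b : A -> Prop := fun p => exists a, K (p - a * b).

Lemma ideal_add_is_ideal K b : is_ideal K -> is_ideal (ideal_add K b).
Proof.
move=> idK; split.
- by exists 0; rewrite mul0r subr0; apply: is_ideal0.
- move=> x y [a Ka] [c Kc]; exists (a + c).
  by rewrite mulrDl opprD addrACA; apply: is_idealD.
- move=> x y [a Ka]; exists (x * a).
  by rewrite -mulrA -mulrBr; apply: is_idealMl.
Qed.

Lemma ideal_add_sub K b p : K p -> ideal_add K b p.
Proof. by exists 0; rewrite mul0r subr0. Qed.

Lemma ideal_add_mem K b : is_ideal K -> ideal_add K b b.
Proof. by move=> idK; exists 1; rewrite mul1r subrr; apply: is_ideal0. Qed.

Lemma gen_ideal_addP G b p :
  gen_ideal (fun q => G q \/ q = b) p <-> ideal_add (gen_ideal G) b p.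
Proof.
have idG := gen_ideal_is_ideal G; split.
  apply: gen_ideal_sub; first exact: ideal_add_is_ideal.
  move=> q [Gq | ->]; last exact: ideal_add_mem.
  exact/ideal_add_sub/gen_ideal_mem.
move=> [a Ga]; have idU := gen_ideal_is_ideal (fun q => G q \/ q = b).
rewrite -(subrK (a * b) p); apply: is_idealD => //.
  by apply: gen_ideal_mono Ga => q; left.
by apply: is_idealMl => //; apply: gen_ideal_mem; right.
Qed.

Definition nzd_mod K b := forall p, K (b * p) -> K p.

Lemma nzd_modX K b n p : nzd_mod K b -> K (b ^+ n * p) -> K p.
Proof.
move=> nzb; elim: n => [|n IHn]; first by rewrite expr0 mul1r.
by rewrite exprS -mulrA => /nzb.
Qed.

(** A relation [b p = q c] modulo [K] gives [q = r b], as [c] is regular modulo [(K, b)]; cancelling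
    [b] then leaves [p = r c]. *)
Lemma nzd_mod_exchange K b c : is_ideal K ->
  nzd_mod K b -> nzd_mod (ideal_add K b) c -> nzd_mod (ideal_add K c) b.
Proof.
move=> idK nzb nzc p [q Kbpcq].
have [|r Kqrb] := nzc q.
  exists p; rewrite (_ : _ - _ = - (b * p - q * c)); last by ring.
  exact: is_idealN.
exists r; apply: nzb.
rewrite (_ : _ * _ = (b * p - q * c) + c * (q - r * b)); last by ring.
by apply: is_idealD => //; apply: is_idealMl.
Qed.

(** Equivalently, the class of [p] modulo [K] vanishes once [a] is inverted. *)
Definition nilpotent_on K p a := exists n, K (a ^+ n * p).

Lemma nilpotent_on_gen K G p a : is_ideal K ->
  (forall b, G b -> nilpotent_on K p b) ->
  gen_ideal G a -> nilpotent_on K p a.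
Proof.
move=> idK nilG; apply: gen_ideal_sub => //; split.
- by exists 1%N; rewrite expr1 mul0r; apply: is_ideal0.
- move=> x y [n Kx] [n' Ky]; exists (n + n')%N.
  rewrite exprDn mulr_suml; apply: is_ideal_sum => // i _.
  rewrite mulrnAl -mulr_natl; apply: is_idealMl => //.
  (* In every term of the binomial expansion, either the exponent of [y] is at least [n'] or that of
     [x] is at least [n]. *)
  case: (leqP n' i) => hi.
    rewrite -{2}(subnK hi) exprD; set z := y ^+ (i - n').
    rewrite (_ : _ * _ = x ^+ (n + n' - i) * z * (y ^+ n' * p)); last by ring.
    exact: is_idealMl.
  have le_n : (n <= n + n' - i)%N by rewrite -addnBA ?leq_addr // ltnW.
  rewrite -(subnK le_n) exprD.
  set z := x ^+ _.
  rewrite (_ : _ * _ = z * y ^+ i * (x ^+ n * p)); last by ring.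
  exact: is_idealMl.
- move=> x y [n Ky]; exists n; rewrite exprMn -mulrA; exact: is_idealMl.
Qed.

End IdealFacts.

(** * Free socles and their exchange *)

Section Socle.
Variables (C : nmodType) (A : comPzRingType) (sc : C -> A) (M : A -> Prop).
Implicit Types (K : A -> Prop) (u v p : A).

(** The quotient [(K : M) / K] is free of rank one over the scalars [C], with basis the class of
    [u]. Below, [C] is [k[theta]] and [M] is the ideal of the [x_j]. *)
Definition free_socle K u :=
  [/\ colon K M u,
      forall p, colon K M p -> exists r, K (p - sc r * u)
    & forall r, K (sc r * u) -> r = 0].

(* [u] and [v] correspond under [c u = b v]: both quotients are
   [Ext^1(A/M, A/K)]. *)
Lemma free_socle_exchange K b c u : is_ideal K -> M b -> M c ->
  nzd_mod K b -> nzd_mod K c ->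
  free_socle (ideal_add K b) u -> exists v, free_socle (ideal_add K c) v.
Proof.
move=> idK Mb Mc nzb nzc [Mu genu freeu].
(* The correspondence respects the two colon ideals. It is stated for arbitrary [b'], [c'] because
   both directions are used. *)
have colon_swap b' c' p q : nzd_mod K b' -> K (c' * p - b' * q) ->
    colon (ideal_add K b') M p -> colon (ideal_add K c') M q.
  move=> nzb' Kpq Mp x /Mp [w Kw]; exists w; apply: nzb'.
  rewrite (_ : _ * _ = c' * (p * x - w * b') - x * (c' * p - b' * q)); last by ring.
  by apply: is_idealB => //; apply: is_idealMl.
have [v Kuv] := Mu c Mc.
have {}Kuv : K (c * u - b * v).
  by rewrite (_ : _ - _ = u * c - v * b) //; ring.
exists v; split; first exact: colon_swap Mu.
- move=> p Mp; have [q Kpq] := Mp b Mb.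
  have {}Kpq : K (b * p - c * q) by rewrite (_ : _ - _ = p * b - q * c) //; ring.
  have [r [w Kqr]] := genu q (colon_swap _ _ _ _ nzc Kpq Mp).
  exists r, w; apply: nzb.
  rewrite (_ : _ * _ = (b * p - c * q) + c * (q - sc r * u - w * b)
     + sc r * (c * u - b * v)); last by ring.
  by apply: is_idealD; [|apply: is_idealD|] => //; apply: is_idealMl.
- move=> r [w Kw]; apply: freeu; exists w; apply: nzc.
  rewrite (_ : _ * _ = sc r * (c * u - b * v) + b * (sc r * v - w * c)); last by ring.
  by apply: is_idealD => //; apply: is_idealMl.
Qed.

End Socle.

(** * Ideals whose generators do not involve one variable *)

Section ConstantGenerators.
Variables (T : comNzRingType) (Phi : {rmorphism T -> {poly T}}) (theta : T).
Variable G : T -> Prop.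
Hypothesis PhiK : forall p, (Phi p).[theta] = p.
Hypothesis PhiG : forall g, G g -> Phi g = g%:P.

Lemma gen_ideal_coef p n : gen_ideal G p -> gen_ideal G (Phi p)`_n.
Proof.
have idG := gen_ideal_is_ideal G.
move=> [N [c [g [Gg ->]]]]; rewrite rmorph_sum coef_sum.
apply: is_ideal_sum => // i _.
rewrite rmorphM (PhiG (Gg i)) coefMC; apply: is_idealMl => //.
exact: gen_ideal_mem.
Qed.

Lemma gen_ideal_of_coefs p : (forall n, gen_ideal G (Phi p)`_n) -> gen_ideal G p.
Proof.
have idG := gen_ideal_is_ideal G.
move=> Gp; rewrite -[p]PhiK horner_coef; apply: is_ideal_sum => // i _.
by apply: is_idealMr.
Qed.

(* Inverting [x] makes [theta * x + g] monic in [theta] up to a unit. *)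
Lemma linear_form_nilpotent x g p : Phi theta = 'X -> Phi x = x%:P ->
  Phi g = g%:P -> gen_ideal G ((theta * x + g) * p) ->
  nilpotent_on (gen_ideal G) p x.
Proof.
have idG := gen_ideal_is_ideal G.
move=> Phith Phix Phig Gp; exists (size (Phi p)).
apply: gen_ideal_of_coefs => n; rewrite rmorphM rmorphXn Phix -rmorphXn coefCM.
(* This is the coefficient of degree [i.+1] in [(theta * x + g) * p]. *)
have {}Gp i : gen_ideal G (x * (Phi p)`_i + g * (Phi p)`_i.+1).
  have := gen_ideal_coef i.+1 Gp.
  rewrite rmorphM rmorphD rmorphM Phith Phix Phig mulrDl coefD coefCM.
  by rewrite -mulrA coefXM /= coefCM.
have: (size (Phi p) <= n + size (Phi p))%N by rewrite leq_addl.
(* Only the exponent is generalized: [x ^+ j] kills the coefficient of index [n] as soon as [n + j]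
   reaches the size of [Phi p]. The induction starts from the zero coefficients beyond the degree
   and descends. *)
elim: {2 3}(size (Phi p)) n => [|j IHj] n.
  by rewrite addn0 => /leq_sizeP -> //; rewrite mulr0; apply: is_ideal0.
rewrite addnS -addSn => /IHj IH.
rewrite (_ : _ * _ = x ^+ j * (x * (Phi p)`_n + g * (Phi p)`_n.+1)
   - g * (x ^+ j * (Phi p)`_n.+1)); last by rewrite exprS; ring.
by apply: is_idealB => //; apply: is_idealMl.
Qed.

End ConstantGenerators.

(** * The ideal of the variables *)

Lemma mpoly_rmorph_ext (n : nat) (R A : comNzRingType)
    (f g : {rmorphism {mpoly R[n]} -> A}) :
  (forall c, f c%:MP = g c%:MP) -> (forall i, f 'X_i = g 'X_i) -> f =1 g.
Proof.
move=> eqC eqX p; rewrite [p]mpolyE !rmorph_sum; apply: eq_bigr => mm _.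
rewrite -mul_mpolyC !rmorphM eqC mpolyXE_id !rmorph_prod; congr (_ * _).
by apply: eq_bigr => i _; rewrite !rmorphXn eqX.
Qed.

(** Stated over any coefficients to serve both [k[x]] and [k[theta][x]]; over [k[theta]] it unfolds
    to [x_ideal]. *)
Definition mvar_ideal (n : nat) (R : comNzRingType) : {mpoly R[n]} -> Prop :=
  gen_ideal (fun p => exists j : 'I_n, p = 'X_j).

Lemma mvar_ideal_sub_const (n : nat) (R : comNzRingType) (p : {mpoly R[n]}) :
  mvar_ideal (p - (p@_0)%:MP).
Proof.
have idx := gen_ideal_is_ideal (fun q : {mpoly R[n]} => exists j : 'I_n, q = 'X_j).
elim/mpolyind: p => [|c mm p _ _ IHp].
  by rewrite mcoeff0 mpolyC0 subrr; apply: is_ideal0.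
rewrite mcoeffD mpolyCD opprD addrACA; apply: is_idealD => //.
rewrite mcoeffZ mcoeffX; have [->|nz_mm] := eqVneq mm 0%MM.
  by rewrite mulr1 mpolyX0 -mul_mpolyC mulr1 subrr; apply: is_ideal0.
rewrite mulr0 mpolyC0 subr0 -mul_mpolyC; apply: is_idealMl => //.
have [j mm_j] : exists j, mm j != 0%N.
  apply/existsP; rewrite -negb_forall; apply: contra nz_mm => /forallP mm0.
  by apply/eqP/mnmP => i; rewrite mnm0E; apply/eqP.
rewrite -(@submK _ U_(j) mm) ?lep1mP // mpolyXD; apply: is_idealMl => //.
by apply: gen_ideal_mem; exists j.
Qed.

Lemma mvar_ideal_homog (n : nat) (R : comNzRingType) (p : {mpoly R[n]}) s :
  (0 < s)%N -> p \is s.-homog -> mvar_ideal p.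
Proof.
move=> s_gt0 p_hom; have := mvar_ideal_sub_const p.
rewrite (dhomog_nemf_coeff p_hom) ?mpolyC0 ?subr0 //= mdeg0.
by rewrite eq_sym -lt0n.
Qed.

(** * Adjoining the variables [theta] *)

Section ExtendedIdeals.
Variables (k : fieldType) (m N : nat).
Local Notation S := {mpoly k[m]}.
Local Notation kth := {mpoly k[N]}.
Local Notation Rup := {mpoly kth[m]}.
Local Notation U := {mpoly S[N]}.

Definition ext_poly : S -> Rup := map_mpoly (@mpolyC N k).
HB.instance Definition _ := GRing.RMorphism.on ext_poly.

(** Passing from [k[theta][x]] to [k[x][theta]] exposes the coefficients in [k[x]], where ideals
    extended from [k[x]] can be tested. *)
Definition swap_vars : Rup -> U :=
  mmap (map_mpoly (@mpolyC m k)) (fun l => ('X_l)%:MP).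
HB.instance Definition _ := GRing.RMorphism.on swap_vars.

Definition unswap_vars : U -> Rup := mmap ext_poly (fun w => ('X_w)%:MP).
HB.instance Definition _ := GRing.RMorphism.on unswap_vars.

Lemma ext_polyC c : ext_poly c%:MP = c%:MP%:MP.
Proof. exact: map_mpolyC. Qed.

Lemma ext_polyX l : ext_poly 'X_l = 'X_l.
Proof. exact: map_mpolyX. Qed.

Lemma swap_vars_const c : swap_vars c%:MP = map_mpoly (@mpolyC m k) c.
Proof. exact: mmapC. Qed.

Lemma swap_varsX l : swap_vars 'X_l = ('X_l)%:MP.
Proof. by rewrite /swap_vars mmapX mmap1U. Qed.

Lemma swap_varsK : cancel swap_vars unswap_vars.
Proof.
apply: (mpoly_rmorph_ext (f := unswap_vars \o swap_vars) (g := idfun)) => [c|l] /=.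
  rewrite swap_vars_const.
  apply: (mpoly_rmorph_ext (f := unswap_vars \o map_mpoly (@mpolyC m k))
    (g := @mpolyC m kth)) => [a|w] /=.
    by rewrite map_mpolyC /unswap_vars mmapC /= ext_polyC.
  by rewrite map_mpolyX /unswap_vars mmapX mmap1U.
by rewrite swap_varsX /unswap_vars mmapC /= ext_polyX.
Qed.

Lemma swap_vars_ext q : swap_vars (ext_poly q) = q%:MP.
Proof.
apply: (mpoly_rmorph_ext (f := swap_vars \o ext_poly) (g := @mpolyC N S)) => [c|l] /=.
  by rewrite ext_polyC swap_vars_const map_mpolyC.
by rewrite ext_polyX swap_varsX.
Qed.

Definition ext_gens (G : S -> Prop) : Rup -> Prop :=
  fun p => exists q, G q /\ p = ext_poly q.

(** The ring [k[x, theta]] is free over [k[x]] on the monomials in [theta], so membership in an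
    extended ideal splits over these monomials. *)
Lemma ext_idealP G p :
  gen_ideal (ext_gens G) p <-> forall a, gen_ideal G (swap_vars p)@_a.
Proof.
have idG := gen_ideal_is_ideal G; have idG' := gen_ideal_is_ideal (ext_gens G).
split=> [[n [c [g [Gg ->]]]] a | Gp].
  rewrite rmorph_sum raddf_sum; apply: is_ideal_sum => // i _.
  have [q [Gq ->]] := Gg i.
  rewrite rmorphM /= swap_vars_ext mulrC mcoeffCM; apply: is_idealMr => //.
  exact: gen_ideal_mem.
rewrite -[p]swap_varsK /unswap_vars /mmap; apply: is_ideal_sum => // a _.
apply: is_idealMr => //=.
apply: (gen_ideal_sub (K := fun q => gen_ideal (ext_gens G) (ext_poly q)) _ _ (Gp a));
  last first.
  by move=> b Gb; apply: gen_ideal_mem; exists b.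
split=> [|b c Gb Gc|b c Gc].
- by rewrite (rmorph0 ext_poly); apply: is_ideal0.
- by rewrite (rmorphD ext_poly); apply: (is_idealD idG' Gb Gc).
- by rewrite (rmorphM ext_poly); apply: (is_idealMl _ idG' Gc).
Qed.

Section OneVariable.
Variable v : 'I_N.

Definition var_coefs0 : kth -> {poly Rup} :=
  mmap (polyC \o @mpolyC m kth \o @mpolyC N k)
    (fun w => if w == v then 'X else ('X_w)%:MP%:P).
HB.instance Definition _ := GRing.RMorphism.on var_coefs0.

(** Provides the map [Phi] of [ConstantGenerators]: expansion in powers of the single variable [v].
    The coefficients are kept in [Rup] so that evaluating at [v] gives back the polynomial. *)
Definition var_coefs : Rup -> {poly Rup} := mmap var_coefs0 (fun l => ('X_l)%:P).
HB.instance Definition _ := GRing.RMorphism.on var_coefs.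

Lemma var_coefsX l : var_coefs 'X_l = ('X_l)%:P.
Proof. by rewrite /var_coefs mmapX mmap1U. Qed.

Lemma var_coefs_theta w :
  var_coefs ('X_w)%:MP = if w == v then 'X else ('X_w)%:MP%:P.
Proof. by rewrite /var_coefs mmapC /= /var_coefs0 mmapX mmap1U. Qed.

Lemma var_coefs_const c : var_coefs c%:MP%:MP = c%:MP%:MP%:P.
Proof. by rewrite /var_coefs mmapC /= /var_coefs0 mmapC. Qed.

Lemma var_coefsK p : (var_coefs p).[('X_v)%:MP] = p.
Proof.
apply: (mpoly_rmorph_ext (f := horner_eval ('X_v)%:MP \o var_coefs)
  (g := idfun)) => [c|l] /=; last by rewrite var_coefsX horner_evalE hornerC.
apply: (mpoly_rmorph_ext
  (f := horner_eval ('X_v)%:MP \o var_coefs \o @mpolyC m kth)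
  (g := @mpolyC m kth)) => [a|w] /=; rewrite horner_evalE.
  by rewrite var_coefs_const hornerC.
by rewrite var_coefs_theta; case: eqP => [->|_]; rewrite ?hornerX ?hornerC.
Qed.

Lemma var_coefs_ext q : var_coefs (ext_poly q) = (ext_poly q)%:P.
Proof.
apply: (mpoly_rmorph_ext (f := var_coefs \o ext_poly) (g := polyC \o ext_poly))
  => [c|l] /=; first by rewrite ext_polyC var_coefs_const.
by rewrite ext_polyX var_coefsX.
Qed.

End OneVariable.
End ExtendedIdeals.

(** * Exchanging parameters for generic linear forms *)

Section MixedIdeals.
Variables (k : fieldType) (m d : nat) (I : {mpoly k[m]} -> Prop).
Variable t : seq {mpoly k[m]}.
Local Notation S := {mpoly k[m]}.
Local Notation kth := {mpoly k[d * m]}.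
Local Notation Rup := {mpoly kth[m]}.
Local Notation ext := (@ext_poly k m (d * m)).

(** Interpolates between the extension of [(I, t)], at [(d, 0)] when [t] has length [d], and [I_up],
    at [(0, d)]. *)
Definition mixed_gens (i j : nat) : Rup -> Prop := fun p =>
  ext_gens (add_gens I (take i t)) p \/
  exists l : 'I_d, (l < j)%N /\ p = generic_form k m l.

Definition mixed_ideal i j := gen_ideal (mixed_gens i j).

Lemma mixed_ideal_is_ideal i j : is_ideal (mixed_ideal i j).
Proof. exact: gen_ideal_is_ideal. Qed.

Lemma mixed_ideal_up : mixed_ideal 0 d = gen_ideal (up_gens d I).
Proof.
congr gen_ideal; apply/funext => p; apply/propext; rewrite /mixed_gens take0.
split=> [[[q [[Iq|//] ->]]|[l [_ ->]]]|[[q [Iq ->]]|[l ->]]].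
- by left; exists q.
- by right; exists l.
- by left; exists q; split=> //; left.
- by right; exists l; rewrite ltn_ord.
Qed.

Lemma mixed_ideal0 i : mixed_ideal i 0 = gen_ideal (ext_gens (add_gens I (take i t))).
Proof.
congr gen_ideal; apply/funext => p; apply/propext.
by split=> [[//|[l [//]]]|Gp]; left.
Qed.

Lemma mixed_ideal_addl i j : (i < size t)%N ->
  mixed_ideal i.+1 j = ideal_add (mixed_ideal i j) (ext t`_i).
Proof.
move=> lt_i; rewrite /mixed_ideal (_ : mixed_gens i.+1 j =
    fun q => mixed_gens i j q \/ q = ext t`_i).
  by apply/funext => p; apply/propext; apply: gen_ideal_addP.
apply/funext => p; apply/propext; rewrite /mixed_gens (take_nth 0) //.
split=> [[[q [[Iq|tq] ->]]|]|[[[q [[Iq|tq] ->]]|]|->]].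
- by left; left; exists q; split=> //; left.
- move: tq; rewrite mem_rcons inE => /orP[/eqP ->|tq]; first by right.
  by left; left; exists q; split=> //; right.
- by move=> fp; left; right.
- by left; exists q; split=> //; left.
- by left; exists q; split=> //; right; rewrite mem_rcons inE tq orbT.
- by right.
- by left; exists t`_i; split=> //; right; rewrite mem_rcons mem_head.
Qed.

Lemma mixed_ideal_addr i (j : 'I_d) :
  mixed_ideal i j.+1 = ideal_add (mixed_ideal i j) (generic_form k m j).
Proof.
rewrite /mixed_ideal (_ : mixed_gens i j.+1 =
    fun q => mixed_gens i j q \/ q = generic_form k m j).
  by apply/funext => p; apply/propext; apply: gen_ideal_addP.
apply/funext => p; apply/propext; rewrite /mixed_gens.
split=> [[|[l [lt_l ->]]]|[[|[l [lt_l ->]]]|->]].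
- by move=> tp; left; left.
- move: lt_l; rewrite ltnS leq_eqVlt => /orP[/eqP/val_inj ->|lt_l].
    by right.
  by left; right; exists l.
- by left.
- by right; exists l; split=> //; apply: ltnW.
- by right; exists j.
Qed.

Lemma mxvec_index_inj (i i' : 'I_d) (j j' : 'I_m) :
  mxvec_index i j = mxvec_index i' j' -> i = i' /\ j = j'.
Proof. by move/cast_ord_inj/enum_rank_inj => [-> ->]. Qed.

Lemma x_ideal_generic_form (i : 'I_d) : x_ideal (generic_form k m i).
Proof.
have idx := gen_ideal_is_ideal (fun p : Rup => exists j : 'I_m, p = 'X_j).
apply: (is_ideal_sum _ idx) => j _; apply: (is_idealMl _ idx).
by apply: gen_ideal_mem; exists j.
Qed.

Lemma var_coefs_generic_form (i i' : 'I_d) (j : 'I_m) : i' != i ->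
  var_coefs (mxvec_index i j) (generic_form k m i') = (generic_form k m i')%:P.
Proof.
move=> ne_i; rewrite /generic_form !rmorph_sum; apply: eq_bigr => l _.
rewrite !rmorphM /= var_coefsX var_coefs_theta; case: eqP => // eq_il.
by have [/eqP] := mxvec_index_inj eq_il; rewrite (negbTE ne_i).
Qed.

(** The generators of the mixed ideal avoid the variables [theta j l]. Isolating one [l] at a time,
    [linear_form_nilpotent] shows that a power of each [x_l] kills any [p] killed by the form. Hence
    so does a power of [b], which can be cancelled. *)
Lemma generic_form_nzd i (j : 'I_d) b : x_ideal b ->
  nzd_mod (mixed_ideal i j) b -> nzd_mod (mixed_ideal i j) (generic_form k m j).
Proof.
move=> xb nzb p Kp; have idK := mixed_ideal_is_ideal i j.
suff [n Kn] : nilpotent_on (mixed_ideal i j) p b by apply: nzd_modX Kn.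
apply: (nilpotent_on_gen idK _ xb) => _ [l ->].
pose v := mxvec_index j l.
pose g : Rup := \sum_(l' < m | l' != l) (theta k j l')%:MP * 'X_l'.
have def_f : generic_form k m j = (theta k j l)%:MP * 'X_l + g.
  by rewrite /generic_form (bigD1 l).
have constG q : mixed_gens i j q -> var_coefs v q = q%:P.
  case=> [[q' [_ ->]]|[l' [lt_l' ->]]]; first exact: var_coefs_ext.
  by apply: var_coefs_generic_form; rewrite neq_ltn lt_l'.
have Phith : var_coefs v ((theta k j l)%:MP : Rup) = 'X by rewrite var_coefs_theta eqxx.
have Phig : var_coefs v g = g%:P.
  rewrite /g !rmorph_sum; apply: eq_bigr => l' ne_l'.
  rewrite !rmorphM /= var_coefsX var_coefs_theta; case: eqP => // eq_l.
  by have [_ /eqP] := mxvec_index_inj eq_l; rewrite (negbTE ne_l').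
move: Kp; rewrite def_f.
pose T : comNzRingType := Rup; pose Phi : {rmorphism T -> {poly T}} := var_coefs v.
have PhiK q : (Phi q).[(theta k j l)%:MP] = q := var_coefsK v q.
have PhiG q : mixed_gens i j q -> Phi q = q%:P := constG q.
exact (@linear_form_nilpotent T Phi _ _ PhiK PhiG 'X_l g p Phith
  (var_coefsX k v l) Phig).
Qed.

Hypothesis size_t : size t = d.
Hypothesis t_x : forall p, p \in t -> mvar_ideal p.
Hypothesis t_reg : forall i, (i < d)%N ->
  nzd_mod (gen_ideal (add_gens I (take i t))) t`_i.

Lemma x_ideal_ext p : mvar_ideal p -> x_ideal (ext p).
Proof.
have idx := gen_ideal_is_ideal (fun p : Rup => exists j : 'I_m, p = 'X_j).
apply: (gen_ideal_sub (K := fun q => x_ideal (ext q))) => [|_ [j ->]].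
  split=> [|a b xa xb|a b xb].
  - by rewrite (rmorph0 ext); apply: is_ideal0.
  - by rewrite (rmorphD ext); apply: (is_idealD idx xa xb).
  - by rewrite (rmorphM ext); apply: (is_idealMl _ idx xb).
by rewrite ext_polyX; apply: gen_ideal_mem; exists j.
Qed.

Lemma x_ideal_ext_t i : (i < d)%N -> x_ideal (ext t`_i).
Proof. by move=> lt_i; apply/x_ideal_ext/t_x/mem_nth; rewrite size_t. Qed.

Lemma ext_nzd i : (i < d)%N -> nzd_mod (mixed_ideal i 0) (ext t`_i).
Proof.
move=> lt_i p; rewrite mixed_ideal0 => /ext_idealP Kp; apply/ext_idealP => a.
apply: (t_reg lt_i); have := Kp a.
by rewrite (rmorphM (@swap_vars k m (d * m))) /= swap_vars_ext mcoeffCM.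
Qed.

Lemma ext_nzd_mixed i j : (i + j < d)%N -> nzd_mod (mixed_ideal i j) (ext t`_i).
Proof.
elim: j i => [|j IHj] i; first by rewrite addn0; apply: ext_nzd.
move=> lt_ij; have lt_i : (i < d)%N by apply: leq_ltn_trans lt_ij; apply: leq_addr.
have lt_j : (j < d)%N.
  by apply: leq_trans lt_ij; rewrite addnS ltnS leqW ?leq_addl.
have lt_ij' : (i + j < d)%N by apply: leq_ltn_trans lt_ij; rewrite addnS.
rewrite (mixed_ideal_addr i (Ordinal lt_j)) /=.
apply: nzd_mod_exchange; [exact: mixed_ideal_is_ideal | exact: IHj |].
rewrite -mixed_ideal_addl ?size_t //.
have lt_i1 : (i.+1 < d)%N.
  by apply: leq_trans lt_ij; rewrite addnS !ltnS leq_addr.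
apply: (@generic_form_nzd i.+1 (Ordinal lt_j) (ext t`_i.+1)).
  exact: x_ideal_ext_t.
by apply: IHj; rewrite addSn -addnS.
Qed.

Variable s : S.
Hypothesis s_soc : colon (gen_ideal (add_gens I t)) (@mvar_ideal m k) s.
Hypothesis s_gen : forall p,
  colon (gen_ideal (add_gens I t)) (@mvar_ideal m k) p ->
  exists c : k, gen_ideal (add_gens I t) (p - c%:MP * s).
Hypothesis s_nz : ~ gen_ideal (add_gens I t) s.

Local Notation scal := (@mpolyC m kth).

Lemma free_socle_ext : free_socle scal (@x_ideal k m d) (mixed_ideal d 0) (ext s).
Proof.
have idx := gen_ideal_is_ideal (fun p : Rup => exists j : 'I_m, p = 'X_j).
have idG := gen_ideal_is_ideal (add_gens I t).
have idK := gen_ideal_is_ideal (ext_gens (N := d * m) (add_gens I t)).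
rewrite mixed_ideal0 take_oversize ?size_t //; split.
- apply: (colon_gen idK) => _ [l ->].
  rewrite -(ext_polyX k (d * m)) -(rmorphM ext); apply/ext_idealP => a.
  rewrite swap_vars_ext mcoeffC; apply: (is_idealMr _ idG).
  by apply: s_soc; apply: gen_ideal_mem; exists l.
- move=> p Kp; pose P := swap_vars p.
  (* Every [theta]-coefficient of [p] lies in the socle modulo [(I, t)], hence is a scalar multiple
     of [s]. *)
  have /(_ _)/cid coefP a :
      exists c : k, gen_ideal (add_gens I t) (P@_a - c%:MP * s).
    apply/s_gen/(colon_gen idG) => _ [l ->].
    have xl : x_ideal ('X_l : Rup) by apply: gen_ideal_mem; exists l.
    have /ext_idealP/(_ a) := Kp _ xl.
    rewrite (rmorphM (@swap_vars k m (d * m))) /= swap_varsX mulrC mcoeffCM.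
    by rewrite mulrC.
  (* The scalars chosen for the coefficients are assembled into one polynomial in [theta];
     restricting to the support of [P] keeps the sum finite. *)
  pose r := \sum_(a <- msupp P) (sval (coefP a)) *: 'X_[a].
  have r_coef a : r@_a = if a \in msupp P then sval (coefP a) else 0.
    rewrite /r raddf_sum /=; case: ifP => [a_in|a_out].
      rewrite (bigD1_seq a) ?msupp_uniq //= mcoeffZ mcoeffX eqxx mulr1.
      by rewrite big1 ?addr0 // => b /negbTE ne_b; rewrite mcoeffZ mcoeffX ne_b mulr0.
    rewrite big1_seq // => b /= b_in; rewrite mcoeffZ mcoeffX.
    case: eqP => [eq_b|_]; last by rewrite mulr0.
    by rewrite -eq_b b_in in a_out.
  exists r; apply/ext_idealP => a.
  rewrite (rmorphB (@swap_vars k m (d * m))) (rmorphM (@swap_vars k m (d * m))) /=.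
  rewrite swap_vars_const swap_vars_ext mcoeffB [_ * s%:MP]mulrC mcoeffCM.
  rewrite mcoeff_map_mpoly /= mulrC r_coef -/P.
  case: ifP => [_|a_out]; first exact: (svalP (coefP a)).
  by rewrite memN_msupp_eq0 ?a_out // mpolyC0 mul0r subr0; apply: is_ideal0.
- move=> r /ext_idealP Kr; apply/mpolyP => a; rewrite mcoeff0.
  have := Kr a; rewrite (rmorphM (@swap_vars k m (d * m))) /= swap_vars_const.
  rewrite swap_vars_ext mulrC mcoeffCM mcoeff_map_mpoly /=.
  have [//|nz_ra] := eqVneq (r@_a) 0 => Gra; case: s_nz.
  (* A nonzero coefficient of [r] is invertible in [k], so [s] itself would lie in the ideal. *)
  rewrite -[s]mul1r -(mpolyC1 m k) -(mulVf nz_ra) mpolyCM -mulrA.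
  by apply: (is_idealMl _ idG); rewrite mulrC.
Qed.

(** Each step replaces the last remaining parameter by the next generic form. Both are
    nonzerodivisors in the ideal of the [x_j] modulo the ideal with neither, so
    [free_socle_exchange] applies. *)
Lemma free_socle_mixed j : (j <= d)%N ->
  exists u, free_socle scal (@x_ideal k m d) (mixed_ideal (d - j) j) u.
Proof.
elim: j => [|j IHj] le_j; first by exists (ext s); rewrite subn0; apply: free_socle_ext.
have [u] := IHj (ltnW le_j); have idK := mixed_ideal_is_ideal (d - j.+1) j.
have lt_dj : (d - j.+1 < d)%N by rewrite ltn_subrL (leq_ltn_trans _ le_j).
have lt_d : (d - j.+1 + j < d)%N by rewrite -addnS subnK.
rewrite -(subnSK le_j) mixed_ideal_addl ?size_t //.
rewrite (mixed_ideal_addr _ (Ordinal le_j)).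
have xt := x_ideal_ext_t lt_dj; have nzt := ext_nzd_mixed lt_d.
have nzf := generic_form_nzd (j := Ordinal le_j) xt nzt.
have xf := x_ideal_generic_form (Ordinal le_j).
by move/(free_socle_exchange idK xt xf nzt nzf).
Qed.

Lemma free_socle_up :
  exists u, free_socle scal (@x_ideal k m d) (gen_ideal (up_gens d I)) u.
Proof. by have := free_socle_mixed (leqnn d); rewrite subnn mixed_ideal_up. Qed.

End MixedIdeals.

(** * From the Gorenstein hypothesis to the free socle of [I_up] *)

Lemma quo_class_eq0 (A : comPzRingType) (G : A -> Prop) p :
  quo_class G p = 0 <-> gen_ideal G p.
Proof.
rewrite -(raddf0 (quo_class G)) -{2}[p]subr0; exact: quo_classP.
Qed.

Lemma zero_is_ideal (A : comPzRingType) : is_ideal (fun a : A => a = 0).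
Proof. by split=> [|a b -> ->|a b ->]; rewrite ?addr0 ?mulr0. Qed.

Lemma krull_dim_unique (A : comPzRingType) n n' :
  krull_dim A n -> krull_dim A n' -> n = n'.
Proof.
move=> [ch max] [ch' max']; case: (ltngtP n n') => // lt_n.
  by case: (max _ lt_n).
by case: (max' _ lt_n).
Qed.

Section GradedQuotients.
Variables (k : fieldType) (m : nat).
Local Notation S := {mpoly k[m]}.
Implicit Types (G I : S -> Prop) (t : seq S).

Lemma gen_ideal_quoP G t p :
  gen_ideal (fun b => b \in [seq quo_class G q | q <- t]) (quo_class G p)
  <-> gen_ideal (add_gens G t) p.
Proof.
set Gt := fun b => _; have idt := gen_ideal_is_ideal (add_gens G t).
have idGt := gen_ideal_is_ideal Gt.
have GGt q : gen_ideal G q -> gen_ideal (add_gens G t) q.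
  by apply: gen_ideal_mono => b; left.
split; last first.
  apply: (gen_ideal_sub (K := fun q => gen_ideal Gt (quo_class G q))).
    split=> [|a b Ka Kb|a b Kb].
    - by rewrite (rmorph0 (quo_class G)); apply: is_ideal0.
    - by rewrite (rmorphD (quo_class G)); apply: (is_idealD idGt Ka Kb).
    - by rewrite (rmorphM (quo_class G)); apply: (is_idealMl _ idGt Kb).
  move=> b [/(@gen_ideal_mem _ G)/quo_class_eq0 ->|tb]; first exact: is_ideal0.
  by apply: gen_ideal_mem; apply: map_f.
(* Some representative of [a] lies in the ideal; any other differs from it by an element of
   [(G)]. *)
suff liftGt a : gen_ideal Gt a ->
    exists2 q, a = quo_class G q & gen_ideal (add_gens G t) q.
  move=> /liftGt [q /quo_classP Gq tq].
  by apply: (is_ideal_congr idt) tq; apply: GGt.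
apply: (gen_ideal_sub (K := fun a =>
    exists2 q, a = quo_class G q & gen_ideal (add_gens G t) q))
  => [|_ /mapP[q tq ->]]; last first.
  by exists q => //; apply: gen_ideal_mem; right.
split=> [|_ _ [q -> tq] [r -> tr]|b _ [q -> tq]].
- by exists 0; [rewrite raddf0|apply: is_ideal0].
- by exists (q + r); [rewrite rmorphD|apply: (is_idealD idt tq tr)].
- have [c ->] := quo_class_surj b.
  by exists (c * q); [rewrite rmorphM|apply: (is_idealMl _ idt tq)].
Qed.

Lemma socleP G p :
  socle (quo_class G p) <-> colon (gen_ideal G) (@mvar_ideal m k) p.
Proof.
split=> [soc|col].
  apply: (colon_gen (gen_ideal_is_ideal G)) => _ [l ->]; apply/quo_class_eq0.
  by rewrite rmorphM; apply: soc; apply: gen_ideal_mem; exists l.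
apply: (colon_gen (zero_is_ideal _)) => _ [l ->].
rewrite -(rmorphM (quo_class G)); apply/quo_class_eq0; apply: col.
by apply: gen_ideal_mem; exists l.
Qed.

(* Both [N_up / I_up] and the socle of the reduction by any homogeneous system
   of parameters, with [theta] adjoined, compute [Ext^d(k[theta], A[theta])]. *)
Lemma gorenstein_free_socle d I : krull_dim (quo I) d -> gorenstein I ->
  exists u, free_socle (@mpolyC m {mpoly k[d * m]}) (@x_ideal k m d)
    (gen_ideal (up_gens d I)) u.
Proof.
move=> dimI [t [[dimt t_hom _] [t_reg _] [s0 [s_soc s_nz s_gen]]]].
have [s def_s] := quo_class_surj s0; rewrite {s0}def_s in s_soc s_nz s_gen.
have size_t := krull_dim_unique dimt dimI.
apply: (@free_socle_up _ _ _ _ t size_t _ _ s).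
- by move=> p /t_hom [n [n_gt0 p_hom]]; apply: mvar_ideal_homog p_hom.
- move=> i lt_i p /gen_ideal_quoP; rewrite -size_t in lt_i.
  rewrite map_take => Gp; apply/gen_ideal_quoP; rewrite map_take.
  apply: t_reg; first by rewrite size_map.
  by rewrite (nth_map 0) // -(rmorphM (quo_class I)).
- exact/socleP.
- move=> p /socleP/s_gen [c /esym]; rewrite /quo_scale -(rmorphM (quo_class _)).
  by move=> /esym/quo_classP; exists c.
- by move=> /quo_class_eq0.
Qed.

End GradedQuotients.

(** * Homomorphisms defined on an ideal *)

Section HomFromIdeal.
Variables (A : comPzRingType) (G : A -> Prop).
Implicit Types phi psi : A -> A.

Lemma hom_from_ideal0 J phi : is_ideal J -> hom_from_ideal J phi -> phi 0 = 0.
Proof.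
move=> idJ /(_ 1 0 0 (is_ideal0 idJ) (is_ideal0 idJ)).
by rewrite mulr0 addr0 mul1r => /eqP; rewrite -subr_eq subrr => /eqP.
Qed.

Lemma hom_from_idealM J phi a x : is_ideal J -> hom_from_ideal J phi -> J x ->
  phi (a * x) = a * phi x.
Proof.
move=> idJ hom Jx; have := hom a x 0 Jx (is_ideal0 idJ).
by rewrite (hom_from_ideal0 idJ hom) !addr0.
Qed.

Lemma hom_from_ideal_comb J phi a b : hom_from_ideal J phi ->
  hom_from_ideal J (fun x => a * phi x + b * x).
Proof. by move=> hom c x y Jx Jy; rewrite hom //; ring. Qed.

Lemma eq_hom_from_gen phi psi x :
  hom_from_ideal (gen_ideal G) phi -> hom_from_ideal (gen_ideal G) psi ->
  (forall g, G g -> phi g = psi g) -> gen_ideal G x -> phi x = psi x.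
Proof.
have idG := gen_ideal_is_ideal G.
move=> homphi hompsi eqG [n [c [g [Gg ->]]]].
elim: n c g Gg => [|n IHn] c g Gg.
  by rewrite !big_ord0 (hom_from_ideal0 idG homphi) (hom_from_ideal0 idG hompsi).
rewrite big_ord_recl; set y := \sum_(i < n) _.
(* Linearity is available only on the ideal, so the tail of the sum must first be placed in it. *)
have Gy : gen_ideal G y.
  by exists n, (fun i => c (lift ord0 i)), (fun i => g (lift ord0 i)).
have Gg0 := gen_ideal_mem (Gg ord0).
rewrite homphi // hompsi // eqG //; congr (_ + _).
by apply: (IHn (fun i => c (lift ord0 i)) (fun i => g (lift ord0 i))).
Qed.

End HomFromIdeal.

(** * Difference quotients of polynomials *)

Section ShiftPoly.
Variable T : comNzRingType.
Implicit Types P Q : {poly T}.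

(** The difference quotient [(P - P(0)) / z]. *)
Definition shift_poly P : {poly T} := Poly (behead P).

Lemma coef_shift_poly P i : (shift_poly P)`_i = P`_i.+1.
Proof. by rewrite coef_Poly nth_behead. Qed.

Lemma shift_polyK P : P = shift_poly P * 'X + (P`_0)%:P.
Proof.
by apply/polyP => -[|i]; rewrite coefD coefMX coefC /= ?add0r // coef_shift_poly addr0.
Qed.

Lemma shift_poly_unique P Q c : P = Q * 'X + c%:P -> shift_poly P = Q.
Proof.
by move->; apply/polyP => i; rewrite coef_shift_poly coefD coefMX coefC /= addr0.
Qed.

Lemma shift_polyD P Q : shift_poly (P + Q) = shift_poly P + shift_poly Q.
Proof. by apply/polyP => i; rewrite coefD !coef_shift_poly coefD. Qed.

Lemma shift_polyC c : shift_poly c%:P = 0.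
Proof. by apply: (@shift_poly_unique _ _ c); rewrite mul0r add0r. Qed.

Lemma shift_polyX : shift_poly 'X = 1.
Proof. by apply: (@shift_poly_unique _ _ 0); rewrite mul1r addr0. Qed.

(** A twisted Leibniz rule. The term in [Q(0)] is the obstruction to linearity; for [Q] in [J] it is
    killed by an element of [N_up]. *)
Lemma shift_polyM P Q :
  shift_poly (P * Q) = P * shift_poly Q + (Q`_0)%:P * shift_poly P.
Proof.
apply: (@shift_poly_unique _ _ (P`_0 * Q`_0)).
rewrite {1}(shift_polyK Q) mulrDr {2}(shift_polyK P) polyCM; ring.
Qed.

End ShiftPoly.

(** * Homomorphisms from [J] to [R] *)

Section HomOfJ.
Variables (k : fieldType) (m d : nat) (I : {mpoly k[m]} -> Prop).
Local Notation kth := {mpoly k[d * m]}.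
Local Notation Rup := {mpoly kth[m]}.
Local Notation K := (gen_ideal (up_gens d I)).
Local Notation cl := (quo_class (z_gens (d := d) I)).
Local Notation J := (J_ideal (d := d) (I := I)).
Local Notation scal := (@mpolyC m kth).

Let idK : is_ideal K := gen_ideal_is_ideal _.
Let idJ : is_ideal J := gen_ideal_is_ideal _.

Lemma z_idealP P : cl P = 0 <-> forall i, K P`_i.
Proof.
have idZ := gen_ideal_is_ideal (z_gens (d := d) I).
split=> [/quo_class_eq0 [n [c [g [Gg ->]]]] i|KP].
  rewrite coef_sum; apply: (is_ideal_sum _ idK) => l _.
  have [q [Gq ->]] := Gg l; rewrite coefMC.
  by apply: (is_idealMl _ idK); apply: gen_ideal_mem.
apply/quo_class_eq0; rewrite -[P]coefK poly_def.
apply: (is_ideal_sum _ idZ) => i _; rewrite -mul_polyC.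
apply: (is_idealMr _ idZ).
apply: (gen_ideal_sub (K := fun q => gen_ideal (z_gens (d := d) I) q%:P) _ _ (KP i)).
  split=> [|a b Ka Kb|a b Kb]; first by rewrite polyC0; apply: is_ideal0.
    by rewrite polyCD; apply: (is_idealD idZ Ka Kb).
  by rewrite polyCM; apply: (is_idealMl _ idZ Kb).
by move=> b Gb; apply: gen_ideal_mem; exists b.
Qed.

Lemma z_class_eqP P Q : cl P = cl Q <-> forall i, K (P`_i - Q`_i).
Proof.
split=> [eqPQ i|KPQ].
  rewrite -coefB; move: i; apply/z_idealP; rewrite rmorphB.
  by apply/eqP; rewrite subr_eq0; apply/eqP.
apply/eqP; rewrite -subr_eq0 -(rmorphB (quo_class _)); apply/eqP/z_idealP => i.
by rewrite coefB.
Qed.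

Lemma J_z : J (z_class d I).
Proof. by apply: gen_ideal_mem; left. Qed.

Lemma J_x (j : 'I_m) : J (cl ('X_j)%:P).
Proof. by apply: gen_ideal_mem; right; exists j. Qed.

(** Compare coefficients in [x_j psi(z) = z psi(x_j)]: degree zero gives [x_j H(0) = 0], and the
    higher degrees determine [psi(x_j)]. *)
Lemma hom_J_structure psi H : hom_from_ideal J psi -> psi (z_class d I) = cl H ->
  N_up I H`_0 /\ forall j : 'I_m, psi (cl ('X_j)%:P) = cl (('X_j)%:P * shift_poly H).
Proof.
move=> hom psiz.
have rel (j : 'I_m) : exists2 W, psi (cl ('X_j)%:P) = cl W
    & forall i, K (('X * W)`_i - (('X_j)%:P * H)`_i).
  have [W psix] := quo_class_surj (psi (cl ('X_j)%:P)); exists W => //.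
  apply/z_class_eqP; rewrite !(rmorphM (quo_class _)) /= -psix -psiz.
  rewrite -(hom_from_idealM _ idJ hom J_z) -(hom_from_idealM _ idJ hom (J_x j)).
  by rewrite mulrC.
split=> [|j].
  apply: (colon_gen idK) => _ [j ->]; have [W _ /(_ 0%N)] := rel j.
  by rewrite coefXM coefCM sub0r => /(is_idealN idK); rewrite opprK mulrC.
have [W -> KW] := rel j; apply/z_class_eqP => i.
by have := KW i.+1; rewrite coefXM !coefCM coef_shift_poly.
Qed.

Variable u : Rup.
Hypothesis u_soc : free_socle scal (@x_ideal k m d) K u.

(** Multiplication by [u / z] on [J]: since [u] kills the constant coefficient of [x] there, [u x]
    equals [u (x - x(0))], which is divisible by [z]. *)
Definition phi_hom (x : Rz d I) : Rz d I :=
  cl (u%:P * shift_poly (sval (cid (quo_class_surj x)))).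

Lemma phi_homE P : phi_hom (cl P) = cl (u%:P * shift_poly P).
Proof.
rewrite /phi_hom; case: cid => Q /= /esym/z_class_eqP KPQ; apply/z_class_eqP => i.
rewrite !coefCM !coef_shift_poly -mulrBr; exact: (is_idealMl _ idK).
Qed.

Lemma J_coef0 P : J (cl P) -> K (u * P`_0).
Proof.
have [Nu _ _] := u_soc.
suff lift x : J x -> exists2 Q, x = cl Q & K (u * Q`_0).
  move=> /lift [Q /z_class_eqP/(_ 0%N) KPQ KQ].
  apply: (is_ideal_congr idK) KQ; rewrite -mulrBr; exact: (is_idealMl _ idK).
apply: (gen_ideal_sub (K := fun x => exists2 Q, x = cl Q & K (u * Q`_0))).
  split=> [|_ _ [P1 -> K1] [P2 -> K2]|a _ [P1 -> K1]].
  - by exists 0; rewrite ?raddf0 // coef0 mulr0; apply: is_ideal0.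
  - exists (P1 + P2); first by rewrite rmorphD.
    by rewrite coefD mulrDr; apply: (is_idealD idK K1 K2).
  - have [Q ->] := quo_class_surj a; exists (Q * P1); first by rewrite rmorphM.
    by rewrite coef0M mulrCA; apply: (is_idealMl _ idK K1).
move=> _ [->|[j ->]].
  by exists 'X; rewrite // coefX mulr0; apply: is_ideal0.
by exists ('X_j)%:P; rewrite // coefC; apply: Nu; apply: gen_ideal_mem; exists j.
Qed.

Lemma phi_hom_is_hom : hom_from_ideal J phi_hom.
Proof.
move=> a x y; have [P ->] := quo_class_surj a.
have [Q ->] := quo_class_surj x; have [Q' ->] := quo_class_surj y => JQ JQ'.
rewrite -(rmorphM (quo_class _)) -(rmorphD (quo_class _)) !phi_homE.
rewrite -(rmorphM (quo_class _)) -(rmorphD (quo_class _)).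
apply/z_class_eqP => i; rewrite -coefB shift_polyD shift_polyM.
rewrite (_ : _ - _ = (u * Q`_0)%:P * shift_poly P); last by rewrite polyCM; ring.
by rewrite coefCM; apply: (is_idealMr _ idK); apply: J_coef0.
Qed.

Lemma phi_hom_z : phi_hom (z_class d I) = cl u%:P.
Proof. by rewrite phi_homE shift_polyX mulr1. Qed.

Lemma phi_hom_choice : vol'_choice d I phi_hom u.
Proof.
have [_ u_gen _] := u_soc.
split; last exact: phi_hom_z.
split=> [|psi hom]; first exact: phi_hom_is_hom.
have [H psiz] := quo_class_surj (psi (z_class d I)).
have [NH psix] := hom_J_structure hom psiz.
have [r KH] := u_gen _ NH.
(* At [z] this reads [H = H(0) + z * shift_poly H] with [H(0) = r u]; at [x_j] the map [phi_hom]
   vanishes and only the multiple of the inclusion remains. *)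
pose a := cl (r%:MP)%:P; pose b := cl (shift_poly H); exists a, b => x0.
apply: (eq_hom_from_gen hom (hom_from_ideal_comb a b phi_hom_is_hom))
  => _ [->|[j ->]].
- rewrite psiz phi_hom_z -!(rmorphM (quo_class _)) -(rmorphD (quo_class _)).
  apply/z_class_eqP => -[|i].
    by rewrite coefD coefMX /= coefCM coefC /= addr0.
  rewrite coefD coefMX /= coefCM coefC /= mulr0 add0r coef_shift_poly subrr.
  exact: is_ideal0.
- rewrite psix phi_homE shift_polyC mulr0 raddf0 mulr0 add0r.
  by rewrite -(rmorphM (quo_class _)) mulrC.
Qed.

(** The [x_j] kill [N_up / I_up], so [a] acts through its constant coefficient in [k[theta]]. *)
Lemma N_up_const a p : N_up I p -> K (a * p - (a@_0)%:MP * p).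
Proof. by move=> Np; rewrite -mulrBl mulrC; apply: Np; apply: mvar_ideal_sub_const. Qed.

(** With [u' = r u] and [u = a(0) u'], freeness gives [a(0) r = 1], and the units of [k[theta]] are
    the nonzero constants. *)
Lemma generator_unit u' a : N_up I u' -> K (u - a * u') ->
  exists2 c : k, c != 0 & K (u' - c%:MP%:MP * u).
Proof.
have [_ u_gen u_free] := u_soc.
move=> Nu' Kuu'; have [r Kr] := u_gen _ Nu'; have Ka := N_up_const a Nu'.
have /u_free/eqP : K ((a@_0 * r - 1)%:MP * u).
  rewrite (_ : _ * u = - (u - a * u') - (a * u' - (a@_0)%:MP * u')
     - (a@_0)%:MP * (u' - r%:MP * u)); last by rewrite mpolyCB mpolyCM mpolyC1; ring.
  apply: (is_idealB idK); last exact: (is_idealMl _ idK).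
  by apply: (is_idealB idK) => //; apply: (is_idealN idK).
rewrite subr_eq0 => /eqP/mpoly_intro_unit/andP[/eqP def_r r0_unit].
by exists r@_0; [rewrite -unitfE | rewrite -def_r].
Qed.

(** Write [phi_hom] as [a phi + b] and evaluate at [z]: the constant coefficient gives [u = a(0) h],
    because [b z] contributes nothing. *)
Lemma vol'_choice_unit phi h : vol'_choice d I phi h ->
  exists2 c : k, c != 0 & K (h - c%:MP%:MP * u).
Proof.
move=> [[hom gen] phiz].
have Nh : N_up I h by have [] := hom_J_structure hom phiz; rewrite coefC.
have [a [b /(_ _ J_z)]] := gen _ phi_hom_is_hom.
rewrite phi_hom_z phiz; have [P ->] := quo_class_surj a.
have [Q ->] := quo_class_surj b.
rewrite -!(rmorphM (quo_class _)) -(rmorphD (quo_class _)) => /z_class_eqP/(_ 0%N).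
rewrite coefD coefMX coefMC coefC /= addr0; exact: generator_unit.
Qed.

End HomOfJ.

(** * Homogeneous components in the [x]-degree *)

Section HomogeneousComponents.
Variables (n : nat) (R : comNzRingType).
Implicit Types p g : {mpoly R[n]}.

Lemma pihomogCM c p s : pihomog mdeg s (c%:MP * p) = c%:MP * pihomog mdeg s p.
Proof. by rewrite !mul_mpolyC linearZ. Qed.

Lemma pihomogM_homog p g s t : g \is t.-homog ->
  pihomog mdeg (s + t)%N (p * g) = pihomog mdeg s p * g.
Proof.
move=> g_hom; pose N := maxn (msize p) s.+1.
have def_p : p = \sum_(i < N) pihomog mdeg i p.
  by apply: pihomog_partitionE; apply: leq_maxl.
have ltsN : (s < N)%N by rewrite leq_maxr.
rewrite {1}def_p mulr_suml raddf_sum (bigD1 (Ordinal ltsN)) //= big1 ?addr0.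
  by rewrite pihomog_dE //; apply: dhomogM => //; apply: pihomogP.
move=> i ne_i; apply: (@pihomog_ne0 _ _ _ (i + t)%N); last first.
  by apply: dhomogM => //; apply: pihomogP.
by rewrite eqn_add2r; apply: contra ne_i => /eqP eq_i; apply/eqP/val_inj.
Qed.

Lemma pihomogM_homog_lt p g s t : g \is t.-homog -> (s < t)%N ->
  pihomog mdeg s (p * g) = 0.
Proof.
move=> g_hom lt_st; have def_p := pihomog_partitionE (leqnn (msize p)).
rewrite {1}def_p mulr_suml raddf_sum big1 // => i _.
apply: (@pihomog_ne0 _ _ _ (i + t)%N); last first.
  by apply: dhomogM => //; apply: pihomogP.
by rewrite gtn_eqF // ltn_addl.
Qed.

Lemma pihomog_ideal (K : {mpoly R[n]} -> Prop) p g s t : is_ideal K -> K g ->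
  g \is t.-homog -> K (pihomog mdeg s (p * g)).
Proof.
move=> idK Kg g_hom; case: (leqP t s) => [le_ts|lt_st].
  by rewrite -(subnK le_ts) pihomogM_homog //; apply: (is_idealMl _ idK).
by rewrite (pihomogM_homog_lt _ g_hom lt_st); apply: is_ideal0.
Qed.

End HomogeneousComponents.

Lemma dhomog_map_mpoly (n : nat) (R R' : nzRingType) (f : {additive R -> R'})
  (p : {mpoly R[n]}) s : p \is s.-homog -> map_mpoly f p \is s.-homog.
Proof.
move=> /dhomogP p_hom; apply/dhomogP => mm.
rewrite mcoeff_msupp mcoeff_map_mpoly => nz; apply: p_hom.
by rewrite mcoeff_msupp; apply: contraNneq nz => ->; rewrite raddf0.
Qed.

Section UpHomogeneous.
Variables (k : fieldType) (m d : nat) (I : {mpoly k[m]} -> Prop).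
Local Notation K := (gen_ideal (up_gens d I)).
Hypothesis hI : homogeneous_ideal I.

Lemma generic_form_homog (i : 'I_d) : generic_form k m i \is 1.-homog.
Proof.
apply: rpred_sum => j _; rewrite mul_mpolyC; apply: rpredZ.
by rewrite dhomogX /= mdeg1.
Qed.

Lemma up_ideal_homogeneous p s : K p -> K (pihomog mdeg s p).
Proof.
have idK := gen_ideal_is_ideal (up_gens d I).
move=> [n [c [g [Gg ->]]]]; rewrite raddf_sum /=; apply: (is_ideal_sum _ idK) => i _.
case: (Gg i) => [[q [Iq ->]]|[l def_g]]; last first.
  apply: (pihomog_ideal _ _ idK (gen_ideal_mem (Gg i)) (t := 1)).
  by rewrite def_g generic_form_homog.
have [n' [c' [g' [Gg' ->]]]] := hI.2 _ Iq.
rewrite rmorph_sum mulr_sumr raddf_sum /=; apply: (is_ideal_sum _ idK) => j _.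
have [Ig' [t g'_hom]] := Gg' j.
rewrite rmorphM mulrA; apply: (pihomog_ideal _ _ idK (t := t)).
  by apply: gen_ideal_mem; left; exists (g' j).
exact: dhomog_map_mpoly.
Qed.

End UpHomogeneous.

(** * Localization at the nonzero scalars *)

Lemma frac_clear_denom (R : idomainType) (c : {fraction R}) :
  exists2 b : R, b != 0 & exists a, FracField.tofrac b * c = FracField.tofrac a.
Proof.
elim/quotW: c => r; exists \d_r; first exact: denom_ratioP.
exists \n_r; unlock FracField.tofrac; rewrite -[LHS]FracField.pi_mul.
apply/eqmodP; rewrite /= /FracField.mulf.
rewrite !numden_Ratio ?oner_neq0 ?mul1r ?denom_ratioP //.
rewrite FracField.equivfE !numden_Ratio ?oner_neq0 ?denom_ratioP //.
by rewrite mulr1 mulrC.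
Qed.

Section Localization.
Variables (R : idomainType) (n : nat) (G : {mpoly R[n]} -> Prop).
Local Notation F := {fraction R}.
Local Notation tofrac := (@FracField.tofrac R).
Local Notation mp := (map_mpoly tofrac : {mpoly R[n]} -> {mpoly F[n]}).

Lemma map_tofrac_inj : injective mp.
Proof.
move=> p q eq_pq; apply/mpolyP => mm; apply/eqP; rewrite -tofrac_eq.
by rewrite -!(mcoeff_map_mpoly tofrac) eq_pq.
Qed.

Lemma mpoly_clear_denom (P : {mpoly F[n]}) :
  exists2 q : R, q != 0 & exists p, (tofrac q)%:MP * P = mp p.
Proof.
elim/mpolyind: P => [|c mm P _ _ [q nzq [p def_p]]].
  by exists 1; [exact: oner_neq0 | exists 0; rewrite mulr0 raddf0].
have [b nzb [a def_a]] := frac_clear_denom c.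
exists (b * q); first by rewrite mulf_neq0.
exists (q%:MP * (a *: 'X_[mm]) + b%:MP * p).
rewrite rmorphD !rmorphM /= -def_p ?mpolyCM !map_mpolyC map_mpolyZ map_mpolyX /= -def_a.
by rewrite -!mul_mpolyC ?mpolyCM; ring.
Qed.

Lemma clear_denom_homog (P : {mpoly F[n]}) q p s : (tofrac q)%:MP * P = mp p ->
  P \is s.-homog -> p \is s.-homog.
Proof.
move=> def_p P_hom; apply/dhomogP => mm; rewrite mcoeff_msupp => nz.
apply: (dhomogP _ _ _ P_hom); rewrite mcoeff_msupp; apply: contraNneq nz => Pmm.
rewrite -tofrac_eq0; have := congr1 (mcoeff mm) def_p.
by rewrite mcoeffCM mcoeff_map_mpoly /= Pmm mulr0 => <-.
Qed.

Definition frac_gens : {mpoly F[n]} -> Prop := fun P => exists q, G q /\ P = mp q.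

Lemma frac_idealP p :
  gen_ideal frac_gens (mp p) <-> exists2 q : R, q != 0 & gen_ideal G (q%:MP * p).
Proof.
have idG := gen_ideal_is_ideal G; have idF := gen_ideal_is_ideal frac_gens.
split.
  (* After clearing a denominator, [P] comes from an element of the original ideal. Such [P] form an
     ideal containing [frac_gens]. *)
  pose L P := exists2 q : R, q != 0
    & exists2 p, (tofrac q)%:MP * P = mp p & gen_ideal G p.
  suff GL P : gen_ideal frac_gens P -> L P.
    move=> /GL [q nzq [p' def_p' Gp']]; exists q => //.
    suff -> : q%:MP * p = p' by [].
    by apply: map_tofrac_inj; rewrite -def_p' rmorphM /= map_mpolyC.
  apply: gen_ideal_sub => [|_ [q [Gq ->]]]; last first.
    exists 1; first exact: oner_neq0.
    by exists q; [rewrite tofrac1 mpolyC1 mul1r | apply: gen_ideal_mem].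
  split=> [|P1 P2 [q1 nz1 [p1 def1 G1]] [q2 nz2 [p2 def2 G2]]
           |P1 P2 [q2 nz2 [p2 def2 G2]]].
  - exists 1; first exact: oner_neq0.
    by exists 0; [rewrite mulr0 raddf0 | apply: is_ideal0].
  - exists (q1 * q2); first by rewrite mulf_neq0.
    exists (q2%:MP * p1 + q1%:MP * p2).
      rewrite rmorphD !rmorphM /= -def1 -def2 !map_mpolyC /= ?mpolyCM; ring.
    by apply: (is_idealD idG); apply: (is_idealMl _ idG).
  - have [q1 nz1 [p1 def1]] := mpoly_clear_denom P1.
    exists (q1 * q2); first by rewrite mulf_neq0.
    exists (p1 * p2); last by apply: (is_idealMl _ idG).
    rewrite !rmorphM /= -def1 -def2 ?mpolyCM; ring.
move=> [q nzq Gqp].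
have -> : mp p = (tofrac q)^-1%:MP * mp (q%:MP * p).
  rewrite rmorphM /= map_mpolyC mulrA -mpolyCM mulVf ?tofrac_eq0 //.
  by rewrite mpolyC1 mul1r.
apply: (is_idealMl _ idF).
apply: (gen_ideal_sub (K := fun q => gen_ideal frac_gens (mp q)) _ _ Gqp).
  split=> [|a b Ka Kb|a b Kb]; first by rewrite raddf0; apply: is_ideal0.
    by rewrite rmorphD; apply: (is_idealD idF Ka Kb).
  by rewrite rmorphM; apply: (is_idealMl _ idF Kb).
by move=> b Gb; apply: gen_ideal_mem; exists b.
Qed.

End Localization.

(** * Scalar multiplication on the quotient *)

Section QuoScale.
Variables (F : fieldType) (n : nat) (G : {mpoly F[n]} -> Prop).
Implicit Types (a b : quo G) (c : F).

Lemma quo_scaleA c c' a : quo_scale c (quo_scale c' a) = quo_scale (c * c') a.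
Proof. by rewrite /quo_scale mulrA -(rmorphM (quo_class G)) -mpolyCM. Qed.

Lemma quo_scale1 a : quo_scale 1 a = a.
Proof. by rewrite /quo_scale mpolyC1 (rmorph1 (quo_class G)) mul1r. Qed.

Lemma quo_scaler0 c : quo_scale c (0 : quo G) = 0.
Proof. exact: mulr0. Qed.

Lemma quo_scaleDl c c' a : quo_scale (c + c') a = quo_scale c a + quo_scale c' a.
Proof. by rewrite /quo_scale mpolyCD (rmorphD (quo_class G)) mulrDl. Qed.

Lemma quo_scale0r a : quo_scale 0 a = 0.
Proof. by rewrite /quo_scale mpolyC0 (rmorph0 (quo_class G)) mul0r. Qed.

Lemma quo_scale_inj a : a <> 0 -> injective (@quo_scale _ _ G ^~ a).
Proof.
move=> nza c c' /= eq_cc'; apply/eqP; rewrite -subr_eq0.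
have [//|nz] := eqVneq (c - c') 0; case: nza.
rewrite -[a]quo_scale1 -(mulVf nz) -quo_scaleA quo_scaleDl eq_cc'.
by rewrite -quo_scaleDl subrr quo_scale0r quo_scaler0.
Qed.

Lemma quo_scale_class c p : quo_scale c (quo_class G p) = quo_class G (c%:MP * p).
Proof. by rewrite /quo_scale -(rmorphM (quo_class G)). Qed.

Lemma quo_degree_scale e c a : quo_degree e a -> quo_degree e (quo_scale c a).
Proof.
move=> [p [p_hom ->]]; exists (c%:MP * p); rewrite quo_scale_class; split=> //.
by rewrite mul_mpolyC; apply: rpredZ.
Qed.

Lemma quo_degree0 e : quo_degree e (0 : quo G).
Proof. by exists 0; rewrite rpred0 raddf0. Qed.

End QuoScale.

Lemma div_rescale (F : fieldType) (a b x : F) : a != 0 ->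
  x / b = a / b * (x / a).
Proof.
by move=> nza; rewrite [x / a]mulrC mulrACA divff // mul1r mulrC.
Qed.

(** * The top degree of the generic Artinian reduction *)

Section Volumes.
Variables (k : fieldType) (m d : nat) (I : {mpoly k[m]} -> Prop) (e : nat).
Local Notation kth := {mpoly k[d * m]}.
Local Notation Rup := {mpoly kth[m]}.
Local Notation E := {fraction kth}.
Local Notation K := (gen_ideal (up_gens d I)).
Local Notation tofrac := (@FracField.tofrac kth).
Local Notation scal := (@mpolyC m kth).
Local Notation dc := (@down_class k m d I).

Hypothesis hI : homogeneous_ideal I.
Hypothesis he : top_degree (down_gens d I) e.
Variable u : Rup.
Hypothesis u_soc : free_socle scal (@x_ideal k m d) K u.

Let idK : is_ideal K := gen_ideal_is_ideal _.

Lemma to_downM (p q : Rup) : to_down (p * q) = to_down p * to_down q.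
Proof. exact: rmorphM. Qed.

Lemma to_downC (r : kth) : to_down (r%:MP : Rup) = (tofrac r)%:MP.
Proof. exact: map_mpolyC. Qed.

Lemma down_class0P p : dc p = 0 <-> exists2 q : kth, q != 0 & K (q%:MP * p).
Proof.
split=> [/quo_class_eq0/(frac_idealP (up_gens d I))//|Kp].
exact/quo_class_eq0/(frac_idealP (up_gens d I)).
Qed.

Lemma down_class_ideal p : K p -> dc p = 0.
Proof.
move=> Kp; apply/down_class0P; exists 1; first exact: oner_neq0.
by rewrite mpolyC1 mul1r.
Qed.

Lemma down_class_eq p q : K (p - q) -> dc p = dc q.
Proof.
move/down_class_ideal => /eqP.
rewrite /down_class /to_down !rmorphB /= subr_eq0 => /eqP //.
Qed.

Lemma down_class_scale r p : dc (r%:MP * p) = quo_scale (tofrac r) (dc p).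
Proof.
by rewrite /down_class quo_scale_class to_downM to_downC.
Qed.

Lemma down_class_scal_neq0 : dc u <> 0.
Proof.
have [_ _ u_free] := u_soc.
by move=> /down_class0P [q /eqP nzq /u_free].
Qed.

Lemma N_upP (p : Rup) : (forall j : 'I_m, K (p * 'X_j)) -> N_up I p.
Proof. by move=> Kp; apply: (colon_gen idK) => _ [j ->]; apply: Kp. Qed.

(** Clear denominators to get [p0]. Each [x_j p0] has degree [e + 1], hence vanishes in the Artinian
    reduction and is killed modulo [I_up] by some nonzero [f j] in [k[theta]]; the product of the
    [f j] carries [p0] into [N_up]. *)
Lemma top_degree_lift (P : {mpoly E[m]}) : P \is e.-homog ->
  exists q : kth, exists p : Rup,
    [/\ q != 0, (tofrac q)%:MP * P = to_down p, p \is e.-homog & N_up I p].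
Proof.
move=> P_hom; have [q0 nzq0 [p0 def_p0]] := mpoly_clear_denom P.
have p0_hom := clear_denom_homog def_p0 P_hom.
have /choice [f f_ann] (j : 'I_m) : exists q : kth, q != 0 /\ K (q%:MP * (p0 * 'X_j)).
  suff /down_class0P [q nzq Kq] : dc (p0 * 'X_j) = 0 by exists q.
  apply: (he.2 e.+1) => //; exists (to_down (p0 * 'X_j)); split=> //.
  apply: dhomog_map_mpoly; rewrite -addn1; apply: dhomogM => //.
  by rewrite dhomogX /= mdeg1.
pose q := \prod_j f j; exists (q * q0), (q%:MP * p0); split.
- by rewrite mulf_neq0 //; apply/prodf_neq0 => j _; have [] := f_ann j.
- by rewrite to_downM to_downC -[to_down p0]def_p0 tofracM mpolyCM mulrA.
- by rewrite mul_mpolyC; apply: rpredZ.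
apply: N_upP => j; have -> : q = (\prod_(i | i != j) f i) * f j.
  by rewrite /q (bigD1 j) //= mulrC.
rewrite mpolyCM -!mulrA; apply: (is_idealMl _ idK).
by have [] := f_ann j.
Qed.

Lemma top_degree_span a : quo_degree e a -> exists c : E, a = quo_scale c (dc u).
Proof.
have [_ u_gen _] := u_soc.
move=> [P [P_hom ->]]; have [q [p [nzq def_p p_hom Np]]] := top_degree_lift P_hom.
have [r Kpr] := u_gen _ Np; exists ((tofrac q)^-1 * tofrac r).
rewrite -quo_scaleA -down_class_scale -(down_class_eq Kpr) /down_class -def_p.
by rewrite -quo_scale_class quo_scaleA mulVf ?quo_scale1 // tofrac_eq0.
Qed.

Lemma down_class_degree : quo_degree e (dc u).
Proof.
have [[a [a_deg nza]] _] := he; have [c def_a] := top_degree_span a_deg.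
have nzc : c != 0.
  by apply/eqP => c0; apply: nza; rewrite def_a c0 quo_scale0r.
rewrite -[dc u]quo_scale1 -(mulVf nzc) -quo_scaleA -def_a.
exact: quo_degree_scale.
Qed.

Lemma N_up_pihomog (p : Rup) s : N_up I p -> N_up I (pihomog mdeg s p).
Proof.
move=> Np; apply: N_upP => j.
have X_hom : ('X_j : Rup) \is 1.-homog by rewrite dhomogX /= mdeg1.
rewrite -(pihomogM_homog _ _ X_hom); apply: up_ideal_homogeneous => //.
by apply: Np; apply: gen_ideal_mem; exists j.
Qed.

(** A nonzero top-degree class lifts to a homogeneous [p = r u] with [r] nonzero. For [s] other than
    [e], comparing components gives [r u_s = 0]; as [u_s = rs u], freeness forces [rs = 0]. *)
Lemma socle_generator_homog : K (u - pihomog mdeg e u).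
Proof.
have [Nu u_gen u_free] := u_soc.
have [[_ [[P [P_hom ->]] nzP]] _] := he.
have [q [p [nzq def_p p_hom Np]]] := top_degree_lift P_hom.
have [r Kpr] := u_gen _ Np.
have nzr : r != 0.
  apply/eqP => r0; apply: nzP; have := down_class_eq Kpr.
  rewrite down_class_scale r0 tofrac0 quo_scale0r /down_class -def_p -quo_scale_class.
  have nztq : tofrac q != 0 by rewrite tofrac_eq0.
  move=> P0; rewrite -[quo_class _ P]quo_scale1 -(mulVf nztq) -quo_scaleA P0.
  exact: quo_scaler0.
have Kus s : s != e -> K (pihomog mdeg s u).
  move=> ne_s; have [rs Krs] := u_gen _ (N_up_pihomog s Nu).
  have Krus : K (r%:MP * pihomog mdeg s u).
    have := up_ideal_homogeneous hI s Kpr.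
    rewrite pihomogB pihomogCM (@pihomog_ne0 _ _ _ e s) 1?eq_sym //.
    by rewrite sub0r => /(is_idealN idK); rewrite opprK.
  suff rs0 : rs = 0 by move: Krs; rewrite rs0 mpolyC0 mul0r subr0.
  have /u_free/eqP : K ((r * rs)%:MP * u).
    have -> : (r * rs)%:MP * u =
        r%:MP * pihomog mdeg s u - r%:MP * (pihomog mdeg s u - rs%:MP * u).
      by rewrite mulrBr opprB addrC subrK mulrA -mpolyCM.
    by apply: (is_idealB idK) => //; apply: (is_idealMl _ idK).
  by rewrite mulf_eq0 (negbTE nzr) => /eqP.
pose N := maxn (msize u) e.+1.
have def_u : u = \sum_(i < N) pihomog mdeg i u.
  by apply: pihomog_partitionE; apply: leq_maxl.
have lteN : (e < N)%N by rewrite leq_maxr.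
rewrite {1}def_u (bigD1 (Ordinal lteN)) //= addrAC subrr add0r.
apply: (is_ideal_sum _ idK) => i ne_i; apply: Kus.
by apply: contra ne_i => /eqP eq_i; apply/eqP/val_inj.
Qed.

Lemma socle_KM_generator : KM_generator d I e u.
Proof.
have [Nu u_gen _] := u_soc; split.
  exists (pihomog mdeg e u); split; [exact: N_up_pihomog | exact: pihomogP |].
  exact/quo_classP/socle_generator_homog.
move=> _ [p [Np _ ->]]; have [r Kr] := u_gen _ Np; exists r%:MP.
exact/quo_classP.
Qed.

Lemma KM_generator_unit u' : KM_generator d I e u' ->
  exists2 c : k, c != 0 & K (u' - c%:MP%:MP * u).
Proof.
move=> [[p [Np _ /quo_classP Kp]] gen'].
have Nu' : N_up I u'.
  apply: N_upP => j; apply: (is_ideal_congr idK (b := p * 'X_j)).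
    by rewrite -mulrBl; apply: (is_idealMr _ idK).
  by apply: Np; apply: gen_ideal_mem; exists j.
have [a /quo_classP Ka] := gen' _ socle_KM_generator.1.
exact: (generator_unit u_soc Nu' Ka).
Qed.

(** * Linear maps normalized at a unit multiple of [u] *)

Section Normalization.
Variables (w : Rup) (c : k).
Hypotheses (nzc : c != 0) (Kw : K (w - c%:MP%:MP * u)).

Lemma tofrac_const_neq0 (c' : k) : c' != 0 -> tofrac c'%:MP != 0.
Proof. by rewrite tofrac_eq0 mpolyC_eq0. Qed.

Lemma down_class_unit : dc w = quo_scale (tofrac c%:MP) (dc u).
Proof. by rewrite (down_class_eq Kw) down_class_scale. Qed.

Lemma normalized_byE v x : normalized_by d I e w v ->
  v (quo_scale x (dc u)) = x / tofrac c%:MP.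
Proof.
move=> [w_deg v_lin v_w].
have v0 : v 0 = 0.
  have := v_lin 1 0 0 (quo_degree0 _ _) (quo_degree0 _ _).
  rewrite quo_scaler0 addr0 mul1r => /eqP.
  by rewrite -subr_eq subrr => /eqP.
have := v_lin (x / tofrac c%:MP) _ 0 w_deg (quo_degree0 _ _).
rewrite v_w v0 mulr1 !addr0 down_class_unit quo_scaleA divfK //.
exact: tofrac_const_neq0.
Qed.

(** The default [0] is taken only off the line spanned by [u], hence only outside degree [e], where
    values are irrelevant. *)
Definition socle_coord (a : artin_red d I) : E :=
  if pselect (exists x, a = quo_scale x (dc u)) is left ex then sval (cid ex) else 0.

Lemma socle_coordE x : socle_coord (quo_scale x (dc u)) = x.
Proof.
rewrite /socle_coord; case: pselect => [ex|[]]; last by exists x.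
case: cid => y /= /esym; exact: (quo_scale_inj down_class_scal_neq0).
Qed.

Lemma normalized_by_exists : exists v, normalized_by d I e w v.
Proof.
exists (fun a => socle_coord a / tofrac c%:MP); split.
- by rewrite down_class_unit; apply/quo_degree_scale/down_class_degree.
- move=> x a b /top_degree_span [y ->] /top_degree_span [z ->].
  rewrite quo_scaleA -(quo_scaleDl (x * y) z (dc u)).
  rewrite [X in X / _ = _]socle_coordE [X in _ = _ * (X / _) + _]socle_coordE.
  by rewrite [X in _ = _ + X / _]socle_coordE mulrDl mulrA.
- by rewrite down_class_unit socle_coordE divff // tofrac_const_neq0.
Qed.

End Normalization.

Lemma normalized_by_unique w v v' c : c != 0 -> K (w - c%:MP%:MP * u) ->
  normalized_by d I e w v -> normalized_by d I e w v' -> agree_on_degree d I e v v'.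
Proof.
move=> nzc Kw nv nv' a /top_degree_span [x ->].
by rewrite (normalized_byE nzc Kw x nv) (normalized_byE nzc Kw x nv').
Qed.

Lemma normalized_by_agree w w' v v' c c' :
  c != 0 -> c' != 0 -> K (w - c%:MP%:MP * u) -> K (w' - c'%:MP%:MP * u) ->
  normalized_by d I e w v -> normalized_by d I e w' v' -> agree_up_to_unit d I e v v'.
Proof.
move=> nzc nzc' Kw Kw' nv nv'; exists (c / c'); split.
  by rewrite mulf_neq0 ?invr_eq0.
move=> a /top_degree_span [x ->].
rewrite (normalized_byE nzc Kw x nv) (normalized_byE nzc' Kw' x nv').
have nzt := tofrac_const_neq0 nzc; have nzt' := tofrac_const_neq0 nzc'.
have -> : tofrac (c / c')%:MP = tofrac c%:MP / tofrac c'%:MP.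
  by apply: (mulIf nzt'); rewrite divfK // -tofracM -mpolyCM divfK.
exact (div_rescale (tofrac c'%:MP) x nzt).
Qed.

End Volumes.

(** * Existence and comparison of the normalizations *)

Theorem proposition3p7 (k : fieldType) (m d : nat) (I : {mpoly k[m]} -> Prop)
    (e : nat) (hm : (1 <= m)%N) (hd : (1 <= d)%N)
    (hI : homogeneous_ideal I)
    (hdim : krull_dim (quo I) d)
    (hgor : gorenstein I)
    (he : top_degree (down_gens d I) e) :
  (exists phi h, vol'_choice d I phi h) /\
  (forall phi h, vol'_choice d I phi h ->
     (exists v, normalized_by d I e h v) /\
     (forall v w, normalized_by d I e h v -> normalized_by d I e h w ->
        agree_on_degree d I e v w)) /\
  (forall v w, is_vol' d I e v -> is_vol' d I e w ->
     agree_up_to_unit d I e v w) /\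
  (exists v, is_KM_vol d I e v) /\
  (forall v w, is_KM_vol d I e v -> is_vol' d I e w ->
     agree_up_to_unit d I e v w).
Proof.
have [u u_soc] := gorenstein_free_socle hdim hgor.
split; [|split; [|split; [|split]]].
- by exists (phi_hom u), u; apply: phi_hom_choice.
- move=> phi h /(vol'_choice_unit u_soc) [c nzc Kc]; split.
    exact: (normalized_by_exists he u_soc nzc Kc).
  by move=> v w; apply: (normalized_by_unique he u_soc nzc Kc).
- move=> v w [phi [h [/(vol'_choice_unit u_soc) [c nzc Kc] nv]]].
  move=> [phi' [h' [/(vol'_choice_unit u_soc) [c' nzc' Kc'] nw]]].
  exact: (normalized_by_agree he u_soc nzc nzc' Kc Kc' nv nw).
- have u_KM := socle_KM_generator hI he u_soc.
  have [c nzc Kc] := KM_generator_unit hI he u_soc u_KM.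
  have [v nv] := normalized_by_exists he u_soc nzc Kc.
  by exists v, u.
- move=> v w [u' [/(KM_generator_unit hI he u_soc) [c nzc Kc] nv]].
  move=> [phi [h [/(vol'_choice_unit u_soc) [c' nzc' Kc'] nw]]].
  exact: (normalized_by_agree he u_soc nzc nzc' Kc Kc' nv nw).
Qed.
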